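(* Let $n\ge 2$ and let $D$ be a proper subdomain of $\mathbb{R}^n$. Then $D$ is uniform if and only if there exists a constant $c_1\ge 1$ such that for any two points $x,y\in D$, $$m_D(x,y)\le c_1\, j_D(x,y).$$
   Context: For a proper subdomain $D$ (non-empty open connected set, $D\ne\mathbb{R}^n$), $\delta_D(z)=\inf\{|z-\xi|:\xi\in\partial D\}$ and $d(D)=\sup\{|x-y|:x,y\in D\}\in(0,\infty]$. The density $m_D(z)$ is $\frac{d(D)}{\delta_D(z)(d(D)-\delta_D(z))}$ if $D$ is bounded, and $\frac{1}{\delta_D(z)}$ (the limit as $d(D)\to\infty$) if $D$ is unbounded. The metric is $m_D(x,y)=\inf_\gamma\int_\gamma m_D(z)\,|dz|$, the infimum being over all rectifiable paths $\gamma$ in $D$ joining $x$ to $y$. The distance ratio metric is $$j_D(x,y)=\frac12\log\left\{\left(1+\frac{|x-y|}{\delta_D(x)}\right)\left(1+\frac{|x-y|}{\delta_D(y)}\right)\right\}.$$ $D$ is called uniform if there is a constant $c\ge 1$ such that each pair of points $z_1,z_2\in D$ can be joined by a rectifiable arc $\gamma$ in $D$ with (i) $\min_{j=1,2}\ell(\gamma(z_j,z))\le c\,\delta_D(z)$ for all $z\in\gamma$, and (ii) $\ell(\gamma)\le c\,|z_1-z_2|$. Here $\ell$ is Euclidean length and $\gamma(z_j,z)$ is the subarc of $\gamma$ between $z_j$ and $z$. *)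

(* Defs.v *)
From HB Require Import structures.
From mathcomp Require Import all_boot all_order all_algebra.
From mathcomp Require Import all_classical all_reals all_analysis.

Set Implicit Arguments.
Unset Strict Implicit.
Unset Printing Implicit Defensive.

Import Order.TTheory GRing.Theory Num.Theory.
Import numFieldNormedType.Exports.

Local Open Scope classical_set_scope.
Local Open Scope ring_scope.

(* The points of R^n are row vectors.  The library's norm on 'rV[R]_n is the
   sup norm: it is used below only for the topology and for boundedness, which
   are the Euclidean ones; every distance and length uses [enorm]. *)
Definition enorm {R : realType} {n : nat} (v : 'rV[R]_n) : R :=
  Num.sqrt (\sum_(i < n) v ord0 i ^+ 2).

Definition proper_subdomain {R : realType} {n : nat} (D : set 'rV[R]_n) : Prop :=
  [/\ D !=set0, open D, connected D & D <> setT].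

Definition boundary {T : topologicalType} (A : set T) : set T :=
  closure A `\` interior A.

Definition bdist {R : realType} {n : nat} (D : set 'rV[R]_n) (z : 'rV[R]_n) : R :=
  inf [set enorm (z - xi) | xi in boundary D].

Definition diameter {R : realType} {n : nat} (D : set 'rV[R]_n) : \bar R :=
  ereal_sup [set (enorm (p.1 - p.2))%:E | p in D `*` D].

Definition m_density {R : realType} {n : nat} (D : set 'rV[R]_n)
    (z : 'rV[R]_n) : R :=
  if `[< bounded_set D >]
  then fine (diameter D) / (bdist D z * (fine (diameter D) - bdist D z))
  else (bdist D z)^-1.

(* Length of g restricted to [a, b]; a :: s lists the points of a subdivision
   of [a, b], so s is empty when a = b. *)
Definition path_length {R : realType} {n : nat} (g : R -> 'rV[R]_n)
    (a b : R) : \bar R :=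
  ereal_sup [set (\sum_(0 <= k < size s)
                    enorm (g (nth b (a :: s) k.+1) - g (nth b (a :: s) k)))%:E
            | s in itv_partition a b].

(* The degenerate parameter interval a = b is allowed, so that a point can be
   joined to itself, also by an arc. *)
Definition rectifiable_path {R : realType} {n : nat} (D : set 'rV[R]_n)
    (x y : 'rV[R]_n) (g : R -> 'rV[R]_n) (a b : R) : Prop :=
  [/\ a <= b, {within `[a, b], continuous g}, g @` `[a, b] `<=` D,
      g a = x /\ g b = y & (path_length g a b < +oo)%E].

Definition rectifiable_arc {R : realType} {n : nat} (D : set 'rV[R]_n)
    (x y : 'rV[R]_n) (g : R -> 'rV[R]_n) (a b : R) : Prop :=
  rectifiable_path D x y g a b /\ set_inj `[a, b] g.

(* Normal representation of g on [a, b]: the point of the path at arc length s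
   from its origin.  It does not depend on the parameter t that is chosen,
   since g is constant on an interval where its length does not increase. *)
Definition arc_length_param {R : realType} {n : nat} (g : R -> 'rV[R]_n)
    (a b : R) (s : R) : 'rV[R]_n :=
  g (xget a [set t | t \in `[a, b] /\ path_length g a t = s%:E]).

Definition line_integral {R : realType} {n : nat} (rho : 'rV[R]_n -> R)
    (g : R -> 'rV[R]_n) (a b : R) : \bar R :=
  (\int[lebesgue_measure]_(s in `[0%R, fine (path_length g a b)])
     (rho (arc_length_param g a b s))%:E)%E.

Definition m_metric {R : realType} {n : nat} (D : set 'rV[R]_n)
    (x y : 'rV[R]_n) : \bar R :=
  ereal_inf [set u | exists (g : R -> 'rV[R]_n) (a b : R),
    rectifiable_path D x y g a b /\ u = line_integral (m_density D) g a b].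

Definition j_metric {R : realType} {n : nat} (D : set 'rV[R]_n)
    (x y : 'rV[R]_n) : R :=
  2^-1 * ln ((1 + enorm (x - y) / bdist D x) * (1 + enorm (x - y) / bdist D y)).

Definition uniform_domain {R : realType} {n : nat} (D : set 'rV[R]_n) : Prop :=
  exists2 c : R, 1 <= c &
    forall z1 z2 : 'rV[R]_n, D z1 -> D z2 ->
      exists (g : R -> 'rV[R]_n) (a b : R),
        [/\ rectifiable_arc D z1 z2 g a b,
            forall t, t \in `[a, b] ->
              (mine (path_length g a t) (path_length g t b)
                 <= (c * bdist D (g t))%:E)%E &
            (path_length g a b <= (c * enorm (z1 - z2))%:E)%E].

(* Main.v *)
Require Import Defs.
From mathcomp Require Import all_boot all_order all_algebra.
From mathcomp Require Import all_classical all_reals all_analysis.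
From mathcomp Require Import measurable_realfun.
From mathcomp Require Import ring lra zify.
Import Order.TTheory GRing.Theory Num.Theory.
Import numFieldNormedType.Exports.
Local Open Scope classical_set_scope.
Local Open Scope ring_scope.

(** Bounded or not, D satisfies 1/delta <= m_D <= 2/delta, where delta is the
    distance to the boundary: if D is bounded, its diameter is at least 2 delta
    ([m_density_bounds]).  Up to constants, m_D is therefore the quasihyperbolic
    metric, and the statement is the Gehring-Osgood characterization of uniform
    domains.

    If D is uniform, join x to y by an arc as in the definition, of length l.
    At arc length s from x, delta is at least (1 + 2 c)^-1 times the smaller of
    delta(x) + s and delta(y) + l - s.  Integrating the inverse gives
    logarithms ([integral_log], [line_integral_le_log]), which are bounded by
    j_D since l <= c |x - y| and ln (1 + m t) <= m ln (1 + t).  The normal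
    representation is available because arc length is continuous
    ([path_length_continuous]), hence takes all intermediate values, and it is
    1-Lipschitz ([arc_length_param_lipschitz]).

    For the converse, geodesics, whose existence would require a compactness
    argument, are replaced by discrete ones.  A step from u to v is admissible
    if the segment [u, v] lies in D and |u - v| <= delta on it.  Advancing by
    delta/2 along a path costs at least 1/3 in the integral of 1/delta, so
    if m_D <= c1 j_D then y can be reached from x in at most 3 c1 j_D(x, y) + 5
    admissible steps ([reach_along_path], [reach_of_m_metric]).  Take a chain
    with the least number of steps.  Since subsegments of admissible segments are
    admissible, a self-intersection of the polygon would yield a shorter chain,
    so that the polygon is an arc ([shortest_chain_polygon_inj]).  Subchains of a
    shortest chain are shortest.  If delta is comparable to rho on a subchain of
    k steps, then its ends are O(k rho) apart and k <= A ln (1 + 4 k) + B, so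
    k is bounded ([chain_quasi_chain]).  It follows that the length of the chain
    up to a vertex is controlled by delta at this vertex as long as the maximum
    of delta has not been reached, and likewise from the other end
    ([quasi_chain_peak]): this is the first condition of uniformity.  For the
    second one, let d = |x - y| and cut the chain at the first and the last
    vertex where delta >= d: both outer parts have length O(d), hence the ends of
    the middle part are O(d) apart, and it has a bounded number of steps, whose
    lengths are O(d) ([quasi_chain_length]). *)

(** * The Euclidean norm *)

Lemma enorm_ge0 {R : realType} {n : nat} (v : 'rV[R]_n) : 0 <= enorm v.
Proof. exact: sqrtr_ge0. Qed.

Lemma sqr_enorm {R : realType} {n : nat} (v : 'rV[R]_n) :
  enorm v ^+ 2 = \sum_(i < n) v ord0 i ^+ 2.
Proof. by rewrite sqr_sqrtr// sumr_ge0// => i _; exact: sqr_ge0. Qed.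

Lemma enorm0 {R : realType} {n : nat} : enorm (0 : 'rV[R]_n) = 0.
Proof. by rewrite /enorm big1 ?sqrtr0// => i _; rewrite mxE expr0n. Qed.

Lemma enormZ {R : realType} {n : nat} (a : R) (v : 'rV[R]_n) :
  enorm (a *: v) = `|a| * enorm v.
Proof.
rewrite /enorm -sqrtr_sqr -sqrtrM ?sqr_ge0// mulr_sumr.
by congr Num.sqrt; apply: eq_bigr => i _; rewrite mxE exprMn.
Qed.

Lemma enormN {R : realType} {n : nat} (v : 'rV[R]_n) : enorm (- v) = enorm v.
Proof. by rewrite -scaleN1r enormZ normrN1 mul1r. Qed.

Lemma enorm_distC {R : realType} {n : nat} (u v : 'rV[R]_n) :
  enorm (u - v) = enorm (v - u).
Proof. by rewrite -enormN opprB. Qed.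

Lemma coord_le_enorm {R : realType} {n : nat} (v : 'rV[R]_n) (i : 'I_n) :
  `|v ord0 i| <= enorm v.
Proof.
rewrite -sqrtr_sqr ler_wsqrtr// (bigD1 i)//= lerDl.
by rewrite sumr_ge0// => j _; exact: sqr_ge0.
Qed.

Lemma enorm_eq0 {R : realType} {n : nat} (v : 'rV[R]_n) :
  (enorm v == 0) = (v == 0).
Proof.
apply/eqP/eqP => [v0|->]; last exact: enorm0.
apply/rowP => i; rewrite mxE; apply/eqP; rewrite -normr_le0 -v0.
exact: coord_le_enorm.
Qed.

Lemma cauchy_schwarz {R : realType} {n : nat} (u v : 'rV[R]_n) :
  \sum_(i < n) u ord0 i * v ord0 i <= enorm u * enorm v.
Proof.
have [/eqP|u0] := eqVneq (enorm u) 0.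
  rewrite enorm_eq0 => /eqP ->.
  by rewrite enorm0 mul0r big1// => i _; rewrite mxE mul0r.
have [/eqP|v0] := eqVneq (enorm v) 0.
  rewrite enorm_eq0 => /eqP ->.
  by rewrite enorm0 mulr0 big1// => i _; rewrite mxE mulr0.
have ugt0 : 0 < enorm u by rewrite lt_neqAle eq_sym u0 enorm_ge0.
have vgt0 : 0 < enorm v by rewrite lt_neqAle eq_sym v0 enorm_ge0.
have uv0 : 0 < 2 * (enorm u * enorm v) by rewrite !mulr_gt0.
rewrite -(ler_pM2l uv0) mulr_sumr.
(* 2 (u_i |v|) (v_i |u|) <= (u_i |v|)^2 + (v_i |u|)^2 *)
apply: (@le_trans _ _ (\sum_(i < n) ((u ord0 i ^+ 2) * enorm v ^+ 2 +
    (v ord0 i ^+ 2) * enorm u ^+ 2))).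
  apply: ler_sum => i _.
  have := sqr_ge0 (u ord0 i * enorm v - v ord0 i * enorm u).
  by nra.
by rewrite big_split/= -!mulr_suml -!sqr_enorm; nra.
Qed.

Lemma ler_enormD {R : realType} {n : nat} (u v : 'rV[R]_n) :
  enorm (u + v) <= enorm u + enorm v.
Proof.
rewrite -(@ler_pXn2r _ 2)// ?nnegrE ?addr_ge0 ?enorm_ge0//.
rewrite sqrrD !sqr_enorm.
under eq_bigr do rewrite mxE sqrrD.
rewrite !big_split/= -!sqr_enorm lerD2r lerD2l.
by rewrite -mulr2n lerMn2r/=; exact: cauchy_schwarz.
Qed.

Lemma enorm_triangle {R : realType} {n : nat} (v u w : 'rV[R]_n) :
  enorm (u - w) <= enorm (u - v) + enorm (v - w).
Proof. by rewrite -(subrKA v) ler_enormD. Qed.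

Lemma ler_enorm_sum {R : realType} {n : nat} (I : Type) (s : seq I)
    (P : pred I) (F : I -> 'rV[R]_n) :
  enorm (\sum_(i <- s | P i) F i) <= \sum_(i <- s | P i) enorm (F i).
Proof.
apply: (big_ind2 (fun x y => enorm x <= y)) => //; first by rewrite enorm0.
by move=> x1 x2 y1 y2 h1 h2; rewrite (le_trans (ler_enormD _ _))// lerD.
Qed.

(** The Euclidean norm is at most the sum of the absolute values of the
    coordinates. *)
Lemma enorm_le_sum {R : realType} {n : nat} (v : 'rV[R]_n) :
  enorm v <= \sum_(i < n) `|v ord0 i|.
Proof.
rewrite -(@ler_pXn2r _ 2)// ?nnegrE ?enorm_ge0 ?sumr_ge0// sqr_enorm.
rewrite [leRHS]expr2 mulr_suml; apply: ler_sum => i _.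
rewrite -real_normK ?num_real// expr2 ler_wpM2l//.
by rewrite (bigD1 i)//= lerDl sumr_ge0.
Qed.

(** * Distance to the boundary *)

Lemma enorm_ball {R : realType} {n : nat} (x w : 'rV[R]_n) (e : R) :
  0 < e -> enorm (w - x) < e -> ball x e w.
Proof.
move=> e0 wx; split => // i j; rewrite ord1 /ball/=.
rewrite distrC; apply: le_lt_trans wx.
by have := coord_le_enorm (w - x) j; rewrite !mxE.
Qed.

Lemma segment_meets_boundary {R : realType} {n : nat} (D : set 'rV[R]_n)
    (x w : 'rV[R]_n) : open D -> D x -> ~ D w ->
  exists2 t : R, 0 <= t <= 1 & boundary D (x + t *: (w - x)).
Proof.
move=> oD Dx Dw.
pose f (t : R) := x + t *: (w - x).
have cf : continuous f.
  by move=> t; apply: cvgD; [exact: cvg_cst|apply: cvgZr_tmp; exact: cvg_id].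
pose T := [set t | 0 <= t /\ ~ D (f t)].
have T1 : T 1 by split => //; rewrite /f scale1r addrC subrK.
have T0 : T !=set0 by exists 1.
have lbT : lbound T 0 by move=> t [].
have hT : has_inf T by split => //; exists 0.
have t0 : 0 <= inf T by exact: lb_le_inf.
have t1 : inf T <= 1 by apply: ge_inf => //; exists 0.
exists (inf T); first by rewrite t0.
rewrite /boundary (interior_id D).1//.
have nD : ~ D (f (inf T)).
  move=> DT.
  have : \forall t \near inf T, D (f t) by apply: cf; exact: open_nbhs_nbhs.
  move=> [e /= e0 He].
  have [t [t0' nDt] tlt] := inf_adherent e0 hT.
  apply: (nDt); apply: He => /=.
  have h : inf T <= t by apply: ge_inf; [exists 0|split].
  by rewrite distrC ger0_norm ?subr_ge0//; lra.
split => // B /cf [e /= e0 He].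
have iT : 0 < inf T.
  rewrite lt_neqAle t0 andbT; apply/eqP => T00.
  by apply: nD; rewrite -T00 /f scale0r addr0.
pose t := inf T - Num.min (e / 2) (inf T / 2).
have tp : 0 < Num.min (e / 2) (inf T / 2) by rewrite lt_min !divr_gt0.
have te : Num.min (e / 2) (inf T / 2) <= e / 2 by rewrite ge_min lexx.
have ti : Num.min (e / 2) (inf T / 2) <= inf T / 2 by rewrite ge_min lexx orbT.
exists (f t); split; last first.
  by apply: He => /=; rewrite /t opprB addrC subrK ger0_norm; lra.
apply: contrapT => nDt.
have : inf T <= t.
  by apply: ge_inf; [exists 0|split => //; rewrite /t; lra].
rewrite /t; lra.
Qed.

Lemma boundary_nonempty {R : realType} {n : nat} (D : set 'rV[R]_n) :
  proper_subdomain D -> boundary D !=set0.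
Proof.
move=> [[x Dx] oD _ DT].
have [w nDw] : exists w, ~ D w.
  by apply/existsNP => h; apply: DT; apply/seteqP; split.
have [t _ bt] := segment_meets_boundary D x w oD Dx nDw.
by exists (x + t *: (w - x)).
Qed.

Lemma bdist_set_nonempty {R : realType} {n : nat} (D : set 'rV[R]_n)
    (z : 'rV[R]_n) : proper_subdomain D ->
  [set enorm (z - xi) | xi in boundary D] !=set0.
Proof. by move=> /boundary_nonempty [xi bxi]; exists (enorm (z - xi)), xi. Qed.

Lemma bdist_le {R : realType} {n : nat} (D : set 'rV[R]_n) (z xi : 'rV[R]_n) :
  boundary D xi -> bdist D z <= enorm (z - xi).
Proof.
move=> bxi; apply: ge_inf; last by exists xi.
by exists 0 => _ [y _ <-]; exact: enorm_ge0.
Qed.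

Lemma bdist_lipschitz {R : realType} {n : nat} (D : set 'rV[R]_n)
    (x y : 'rV[R]_n) : proper_subdomain D ->
  bdist D x <= bdist D y + enorm (x - y).
Proof.
move=> hD; rewrite -lerBlDr; apply: lb_le_inf; first exact: bdist_set_nonempty.
move=> _ [xi bxi <-]; rewrite lerBlDr (le_trans (bdist_le D x xi bxi))//.
by rewrite [leRHS]addrC; exact: enorm_triangle.
Qed.

Lemma bdist_norm_lipschitz {R : realType} {n : nat} (D : set 'rV[R]_n)
    (x y : 'rV[R]_n) : proper_subdomain D ->
  `|bdist D x - bdist D y| <= enorm (x - y).
Proof.
move=> hD; rewrite ler_distl; apply/andP; split.
  by rewrite lerBlDr enorm_distC bdist_lipschitz.
exact: bdist_lipschitz.
Qed.

Lemma bdist_gt0 {R : realType} {n : nat} (D : set 'rV[R]_n) (x : 'rV[R]_n) :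
  proper_subdomain D -> D x -> 0 < bdist D x.
Proof.
move=> hD Dx; have [_ oD _ _] := hD.
have : nbhs x D by exact: open_nbhs_nbhs.
rewrite -nbhs_ballE => -[e /= e0 He]; apply: (lt_le_trans e0).
apply: lb_le_inf; first exact: bdist_set_nonempty.
move=> _ [xi [_ nxi] <-]; rewrite leNgt; apply/negP => xe.
apply: nxi; rewrite (interior_id D).1//; apply: He.
by apply: enorm_ball => //; rewrite enorm_distC.
Qed.

Lemma bdist_le_compl {R : realType} {n : nat} (D : set 'rV[R]_n)
    (x w : 'rV[R]_n) : proper_subdomain D -> D x -> ~ D w ->
  bdist D x <= enorm (w - x).
Proof.
move=> hD Dx Dw; have [_ oD _ _] := hD.
have [t /andP[t0 t1] bt] := segment_meets_boundary D x w oD Dx Dw.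
apply: (le_trans (bdist_le D x _ bt)).
rewrite opprD addrA subrr add0r enormN enormZ ger0_norm//.
by rewrite ler_piMl ?enorm_ge0.
Qed.

(** The open Euclidean ball of radius [bdist D x] about x lies in D. *)
Lemma ball_bdist_sub {R : realType} {n : nat} (D : set 'rV[R]_n)
    (x w : 'rV[R]_n) : proper_subdomain D -> D x ->
  enorm (w - x) < bdist D x -> D w.
Proof.
move=> hD Dx wx; apply: contrapT => nDw.
by have := bdist_le_compl D x w hD Dx nDw; rewrite leNgt wx.
Qed.

(** * The density is comparable to 1/delta *)

Lemma diameter_ge {R : realType} {n : nat} (D : set 'rV[R]_n)
    (x y : 'rV[R]_n) : D x -> D y -> ((enorm (x - y))%:E <= diameter D)%E.
Proof. by move=> Dx Dy; apply: ereal_sup_ubound; exists (x, y). Qed.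

Lemma diameter_fin_num {R : realType} {n : nat} (D : set 'rV[R]_n) :
  D !=set0 -> bounded_set D -> diameter D \is a fin_num.
Proof.
move=> [x Dx] [M [_ HM]].
have M1 : M < M + 1 by rewrite ltrDl.
have {HM}HM y : D y -> `|y| <= M + 1 by exact: HM.
rewrite ge0_fin_numE; last first.
  by apply: le_trans (diameter_ge D x x Dx Dx); rewrite subrr enorm0.
apply: (@le_lt_trans _ _ (\sum_(i < n) ((M + 1) + (M + 1)))%:E); last exact: ltry.
apply: ge_ereal_sup => _ [[u v] /= [Du Dv] <-]; rewrite lee_fin.
apply: (le_trans (enorm_le_sum _)); apply: ler_sum => i _.
rewrite !mxE (le_trans (ler_normB _ _))//.
apply: lerD.
  by apply: le_trans (HM _ Du); rewrite /Num.norm/= mx_normrE (le_bigmax _ _ (ord0, i)).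
by apply: le_trans (HM _ Dv); rewrite /Num.norm/= mx_normrE (le_bigmax _ _ (ord0, i)).
Qed.

Lemma bdist_le_diameter {R : realType} {n : nat} (D : set 'rV[R]_n)
    (z : 'rV[R]_n) : (0 < n)%N -> proper_subdomain D -> bounded_set D -> D z ->
  2 * bdist D z <= fine (diameter D).
Proof.
move=> n0 hD bD Dz; have dfin : diameter D \is a fin_num.
  by apply: diameter_fin_num => //; exists z.
have [dlt|//] := ltP (fine (diameter D)) (2 * bdist D z).
have dz := bdist_gt0 D z hD Dz.
pose e : 'rV[R]_n := delta_mx ord0 (Ordinal n0).
have ne : enorm e = 1.
  rewrite /enorm (bigD1 (Ordinal n0))//= big1 => [|i ni].
    by rewrite mxE !eqxx addr0 expr1n sqrtr1.
  by rewrite mxE (negbTE ni) andbF expr0n.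
have d0 : 0 <= fine (diameter D).
  rewrite fine_ge0//; apply: le_trans (diameter_ge D z z Dz Dz).
  by rewrite subrr enorm0.
(* the points z +- s e with s between diam/2 and delta are in D *)
pose s := (fine (diameter D) / 2 + bdist D z) / 2.
have s0 : 0 <= s by rewrite /s; lra.
have hs : s < bdist D z by rewrite /s; lra.
have Dp : D (z + s *: e).
  by apply: (ball_bdist_sub D z) => //; rewrite addrC addKr enormZ ne ger0_norm ?mulr1.
have Dm : D (z - s *: e).
  apply: (ball_bdist_sub D z) => //.
  by rewrite addrC addKr enormN enormZ ne ger0_norm ?mulr1.
have := diameter_ge D _ _ Dp Dm.
have -> : z + s *: e - (z - s *: e) = (2 * s) *: e.
  by rewrite opprB addrC addrA subrK -scalerDl mulr2n mulrDl mul1r.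
by rewrite -(fineK dfin) lee_fin enormZ ne mulr1 ger0_norm ?mulr_ge0// /s; lra.
Qed.

(** The case split of the definition of the density is immaterial up to a
    factor 2, because a bounded domain has diameter at least twice the distance
    of any of its points to the boundary. *)
Lemma m_density_bounds {R : realType} {n : nat} (D : set 'rV[R]_n)
    (z : 'rV[R]_n) : (0 < n)%N -> proper_subdomain D -> D z ->
  (bdist D z)^-1 <= m_density D z <= 2 * (bdist D z)^-1.
Proof.
move=> n0 hD Dz; have dz := bdist_gt0 D z hD Dz.
rewrite /m_density; case: ifPn => [/asboolP bD|_]; last first.
  by rewrite lexx/= ler_peMl ?invr_ge0 ?(ltW dz)// ler1n.
have h := bdist_le_diameter D z n0 hD bD Dz.
set d := fine _ in h *; set r := bdist D z in dz h *.
have dr : 0 < d - r by lra.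
rewrite invfM mulrCA; apply/andP; split.
  by rewrite ler_peMr ?invr_ge0 ?(ltW dz)// ler_pdivlMr//; lra.
by rewrite mulrC ler_wpM2r ?invr_ge0 ?(ltW dz)// ler_pdivrMr//; lra.
Qed.

(** * Length of paths *)

(** Length of the polygonal line with vertices g a, followed by the images of
    the points of s. *)
Fixpoint chord_sum {R : realType} {n : nat} (g : R -> 'rV[R]_n) (a : R)
    (s : seq R) : R :=
  if s is x :: s' then enorm (g x - g a) + chord_sum g x s' else 0.

Lemma chord_sumE {R : realType} {n : nat} (g : R -> 'rV[R]_n) (b a : R)
    (s : seq R) :
  \sum_(0 <= k < size s) enorm (g (nth b (a :: s) k.+1) - g (nth b (a :: s) k))
    = chord_sum g a s.
Proof.
elim: s a => [|x s IH] a; first by rewrite big_nil.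
by rewrite big_nat_recl//= -(IH x).
Qed.

Lemma path_lengthE {R : realType} {n : nat} (g : R -> 'rV[R]_n) (a b : R) :
  path_length g a b =
    ereal_sup [set (chord_sum g a s)%:E | s in itv_partition a b].
Proof.
rewrite /path_length; congr ereal_sup; apply: eq_imagel => s _.
by rewrite chord_sumE.
Qed.

Lemma chord_sum_le {R : realType} {n : nat} (g : R -> 'rV[R]_n) (a b : R)
    (s : seq R) : itv_partition a b s ->
  ((chord_sum g a s)%:E <= path_length g a b)%E.
Proof. by move=> abs; rewrite path_lengthE; apply: ereal_sup_ubound; exists s. Qed.

Lemma path_length_chord {R : realType} {n : nat} (g : R -> 'rV[R]_n)
    (a b : R) : a <= b -> ((enorm (g b - g a))%:E <= path_length g a b)%E.
Proof.
rewrite le_eqVlt => /predU1P[<-|ab].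
  rewrite subrr enorm0; apply: (@chord_sum_le _ _ g a a [::]).
  by split => /=.
have /(chord_sum_le g a b) := itv_partition1 ab.
by rewrite /= addr0.
Qed.

Lemma path_length_ge0 {R : realType} {n : nat} (g : R -> 'rV[R]_n) (a b : R) :
  a <= b -> (0 <= path_length g a b)%E.
Proof.
move=> ab; apply: le_trans (path_length_chord g a b ab).
by rewrite lee_fin enorm_ge0.
Qed.

Lemma path_length_xx {R : realType} {n : nat} (g : R -> 'rV[R]_n) (a : R) :
  path_length g a a = 0%E.
Proof.
apply/eqP; rewrite eq_le path_length_ge0// andbT path_lengthE.
by apply: ge_ereal_sup => _ [s /itv_partitionxx -> <-].
Qed.

Lemma chord_sum_cat {R : realType} {n : nat} (g : R -> 'rV[R]_n) (a : R)
    (s t : seq R) :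
  chord_sum g a (s ++ t) = chord_sum g a s + chord_sum g (last a s) t.
Proof. by elim: s a => [|x s IH] a/=; rewrite ?add0r// IH addrA. Qed.

Lemma path_length_superadditive {R : realType} {n : nat} (g : R -> 'rV[R]_n)
    (a b c : R) : a <= b -> b <= c ->
  (path_length g a b + path_length g b c <= path_length g a c)%E.
Proof.
move=> ab bc.
have H s t : itv_partition a b s -> itv_partition b c t ->
    ((chord_sum g a s)%:E + (chord_sum g b t)%:E <= path_length g a c)%E.
  move=> abs bct; have := chord_sum_le g a c _ (itv_partition_cat abs bct).
  by rewrite chord_sum_cat; case: abs => _ /eqP ->; rewrite EFinD.
have H1 s : itv_partition a b s ->
    ((chord_sum g a s)%:E + path_length g b c <= path_length g a c)%E.
  move=> abs; rewrite -leeBrDl//; rewrite [leLHS]path_lengthE.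
  apply: ge_ereal_sup => _ [t bct <-].
  by rewrite leeBrDl//; exact: H.
have [fbc|] := boolP (path_length g b c \is a fin_num); last first.
  rewrite ge0_fin_numE ?path_length_ge0// -leNgt leye_eq => /eqP bcy.
  have [s abs] : itv_partition a b !=set0.
    move: ab; rewrite le_eqVlt => /predU1P[<-|]; first by exists [::]; split => /=.
    by exists [:: b]; exact: itv_partition1.
  have := H1 s abs; rewrite bcy addey// leye_eq => /eqP ->.
  by rewrite leey.
rewrite -leeBrDr//; rewrite [leLHS]path_lengthE.
apply: ge_ereal_sup => _ [s abs <-].
by rewrite leeBrDr//; exact: H1.
Qed.

Lemma path_length_subadditive {R : realType} {n : nat} (g : R -> 'rV[R]_n)
    (a b c : R) : a <= b -> b <= c ->
  (path_length g a c <= path_length g a b + path_length g b c)%E.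
Proof.
move=> ab bc; rewrite [leLHS]path_lengthE; apply: ge_ereal_sup => _ [s acs <-].
elim: s a ab acs => [|x s IH] a ab acs.
  by rewrite /= adde_ge0// path_length_ge0.
have [xb|bx] := leP x b.
  have ax : a <= x by case: acs => /= /andP[/ltW].
  rewrite /= EFinD; apply: (@le_trans _ _
    ((enorm (g x - g a))%:E + (path_length g x b + path_length g b c)))%E.
    by rewrite leeD2l// IH//; exact: itv_partition_cons acs.
  rewrite addeA leeD2r//; apply: le_trans (path_length_superadditive g a x b ax xb).
  by rewrite leeD2r// path_length_chord.
have bcs : itv_partition b c (x :: s).
  by case: acs => /= /andP[_ p] l; split => //=; rewrite bx.
apply: (@le_trans _ _ ((enorm (g b - g a))%:E + (chord_sum g b (x :: s))%:E)%E).
  rewrite -EFinD lee_fin/= addrA lerD2r addrC; exact: enorm_triangle.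
by rewrite leeD ?path_length_chord// chord_sum_le.
Qed.

Lemma path_lengthD {R : realType} {n : nat} (g : R -> 'rV[R]_n)
    (a b c : R) : a <= b -> b <= c ->
  path_length g a c = (path_length g a b + path_length g b c)%E.
Proof.
move=> ab bc; apply/eqP; rewrite eq_le path_length_subadditive//=.
exact: path_length_superadditive.
Qed.

(** A path whose increments are dominated by those of F has length at most the
    increment of F. *)
Lemma path_length_le {R : realType} {n : nat} (g : R -> 'rV[R]_n) (F : R -> R)
    (a b : R) : (forall s t, s <= t -> enorm (g t - g s) <= F t - F s) ->
  (path_length g a b <= (F b - F a)%:E)%E.
Proof.
move=> gF; rewrite path_lengthE; apply: ge_ereal_sup => _ [s abs <-].
rewrite lee_fin; elim: s a abs => [|x s IH] a abs.
  by rewrite (itv_partition_nil abs)/= subrr.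
have ax : a <= x by case: abs => /= /andP[/ltW].
have := IH x (itv_partition_cons abs); have := gF _ _ ax => /=; lra.
Qed.

Lemma coord_TV_le {R : realType} {n : nat} (g : R -> 'rV[R]_n) (a b : R)
    (i : 'I_n) :
  (total_variation a b (fun t => g t ord0 i) <= path_length g a b)%E.
Proof.
apply: ge_ereal_sup => _ [_ [s abs <-] <-].
apply: le_ereal_sup_tmp; eexists; first by exists s.
rewrite lee_fin; apply: ler_sum => k _ /=.
by have := coord_le_enorm (g (nth b s k) - g (nth b (a :: s) k)) i; rewrite !mxE.
Qed.

Lemma path_length_le_TV {R : realType} {n : nat} (g : R -> 'rV[R]_n)
    (a b : R) :
  (path_length g a b <=
     \sum_(i < n) total_variation a b (fun t => g t ord0 i))%E.
Proof.
apply: ge_ereal_sup => _ [s abs <-].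
apply: (@le_trans _ _ (\sum_(i < n) (variation a b (fun t => g t ord0 i) s)%:E)%E).
  rewrite sumEFin lee_fin /variation exchange_big/=; apply: ler_sum => k _.
  apply: (le_trans (enorm_le_sum _)); apply: ler_sum => i _.
  by rewrite !mxE.
apply: lee_sum => i _; apply: ereal_sup_ubound.
by exists (variation a b (fun t => g t ord0 i) s) => //; exact: variations_variation.
Qed.

Lemma path_length_fin {R : realType} {n : nat} (g : R -> 'rV[R]_n)
    (a b s t : R) : a <= s -> s <= t -> t <= b ->
  (path_length g a b < +oo)%E -> path_length g s t \is a fin_num.
Proof.
move=> as_ st tb lb; rewrite ge0_fin_numE ?path_length_ge0//.
apply: le_lt_trans lb.
rewrite (path_lengthD g a s b as_ (le_trans st tb)) (path_lengthD g s t b st tb).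
rewrite addeCA -[leLHS]adde0 leeD2l//.
by rewrite adde_ge0// path_length_ge0.
Qed.

Lemma fine_path_lengthB {R : realType} {n : nat} (g : R -> 'rV[R]_n)
    (a b s t : R) : a <= s -> s <= t -> t <= b ->
  (path_length g a b < +oo)%E ->
  fine (path_length g a t) - fine (path_length g a s) =
  fine (path_length g s t).
Proof.
move=> as_ st tb lb; rewrite (path_lengthD g a s t as_ st) fineD.
- by rewrite addrC addKr.
- by apply: (path_length_fin g a b) => //; exact: le_trans tb.
- exact: (path_length_fin g a b).
Qed.

Lemma continuous_within_dominated {R : realType} (A : set R) (f V : R -> R) :
  {within A, continuous V} ->
  (forall s t, A s -> A t -> `|f s - f t| <= `|V s - V t|) ->
  {within A, continuous f}.
Proof.
move=> cV H; apply/subspace_continuousP => x Ax.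
move/subspace_continuousP : cV => /(_ x Ax) /cvgrPdist_lt cV.
apply/cvgrPdist_lt => e /cV; apply: filterS2; last exact: withinT.
by move=> t tab; apply: le_lt_trans; exact: H.
Qed.

(** The arc length is a continuous function of the parameter: its increments
    are dominated by those of the sum of the total variations of the
    coordinates. *)
Lemma path_length_continuous {R : realType} {n : nat} (g : R -> 'rV[R]_n)
    (a b : R) : a < b -> {within `[a, b], continuous g} ->
  (path_length g a b < +oo)%E ->
  {within `[a, b], continuous (fun t => fine (path_length g a t))}.
Proof.
move=> ab cg lb.
pose gi (i : 'I_n) (t : R) := g t ord0 i.
pose V t := \sum_(i < n) fine (total_variation a t (gi i)).
have TVfin i s t : a <= s -> s <= t -> t <= b ->
    total_variation s t (gi i) \is a fin_num.
  move=> as_ st tb; rewrite ge0_fin_numE ?total_variation_ge0//.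
  apply: (le_lt_trans (coord_TV_le g s t i)).
  by rewrite ltey_eq (path_length_fin g a b).
have cV : {within `[a, b], continuous V}.
  apply: continuous_big => [|i _]; first exact: add_continuous.
  apply: (total_variation_continuous ab).
    move=> y; apply: (@continuous_comp (subspace `[a, b]%classic) _ _ g
      (fun v : 'rV[R]_n => v ord0 i)).
      exact: cg.
    exact: coord_continuous.
  by apply/(bounded_variationP _ (ltW ab)); apply: TVfin => //; exact: ltW.
have H s t : a <= s -> s <= t -> t <= b ->
    0 <= fine (path_length g a t) - fine (path_length g a s) <= V t - V s.
  move=> as_ st tb; rewrite (fine_path_lengthB g a b)//.
  rewrite fine_ge0 ?path_length_ge0//=.
  have := path_length_le_TV g s t.
  rewrite -(fineK (path_length_fin g a b s t as_ st tb lb)).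
  under eq_bigr => i _ do rewrite -(fineK (TVfin i s t as_ st tb)).
  rewrite sumEFin lee_fin => /le_trans; apply.
  rewrite /V -sumrB le_eqVlt; apply/orP; left; apply/eqP; apply: eq_bigr => i _.
  rewrite (total_variationD (gi i) as_ st) fineD ?TVfin//; last exact: le_trans tb.
  by rewrite addrC addKr.
apply: (continuous_within_dominated _ _ V cV) => s t.
rewrite /= !in_itv/= => /andP[as_ sb] /andP[at_ tb].
have [st|/ltW ts] := leP s t.
  have /andP[h1 h2] := H s t as_ st tb.
  by rewrite distrC (distrC (V s)) !ger0_norm// (le_trans h1).
have /andP[h1 h2] := H t s at_ ts sb.
by rewrite !ger0_norm// (le_trans h1).
Qed.

(** * The normal representation *)

Lemma arc_length_attained {R : realType} {n : nat} (g : R -> 'rV[R]_n)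
    (a b s : R) : a <= b -> {within `[a, b], continuous g} ->
  (path_length g a b < +oo)%E -> 0 <= s <= fine (path_length g a b) ->
  exists t, t \in `[a, b] /\ path_length g a t = s%:E.
Proof.
rewrite le_eqVlt => /predU1P[<-{b} _ _|ab cg lb /andP[s0 sl]].
  rewrite path_length_xx/= => s0; exists a; split.
    by rewrite in_itv/= lexx.
  by rewrite path_length_xx -(le_anti s0).
have [] := @IVT R (fun t => fine (path_length g a t)) a b s (ltW ab).
- exact: path_length_continuous.
- rewrite path_length_xx/= min_l ?max_r ?s0//;
    by rewrite fine_ge0 ?path_length_ge0// ltW.
move=> t tab ts; exists t; split => //.
have := tab; rewrite in_itv/= => /andP[at_ tb].
by rewrite -ts fineK// (path_length_fin g a b).
Qed.

Lemma arc_length_paramP {R : realType} {n : nat} (g : R -> 'rV[R]_n)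
    (a b s : R) : a <= b -> {within `[a, b], continuous g} ->
  (path_length g a b < +oo)%E -> 0 <= s <= fine (path_length g a b) ->
  exists t, [/\ a <= t <= b, path_length g a t = s%:E &
                arc_length_param g a b s = g t].
Proof.
move=> ab cg lb sl.
have [|tab ts] := xgetPex a
  (P := [set t | t \in `[a, b] /\ path_length g a t = s%:E]).
  exact: arc_length_attained.
by exists (xget a [set t | t \in `[a, b] /\ path_length g a t = s%:E]).
Qed.

Lemma arc_length_param_lipschitz {R : realType} {n : nat}
    (g : R -> 'rV[R]_n) (a b s s' : R) :
  a <= b -> {within `[a, b], continuous g} -> (path_length g a b < +oo)%E ->
  0 <= s -> s <= s' -> s' <= fine (path_length g a b) ->
  enorm (arc_length_param g a b s' - arc_length_param g a b s) <= s' - s.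
Proof.
move=> ab cg lb s0 ss' s'l.
have [|t [/andP[at_ tb] ts ->]] := arc_length_paramP g a b s ab cg lb.
  by rewrite s0 (le_trans ss').
have [|t' [/andP[at'_ t'b] ts' ->]] := arc_length_paramP g a b s' ab cg lb.
  by rewrite s'l (le_trans s0).
have [tt'|/ltW t't] := leP t t'.
  have := fine_path_lengthB g a b t t' at_ tt' t'b lb.
  rewrite ts ts' /= => ->.
  rewrite -lee_fin fineK ?path_length_chord//.
  exact: (path_length_fin g a b).
have := fine_path_lengthB g a b t' t at'_ t't tb lb.
rewrite ts ts' /= => h.
have := path_length_chord g t' t t't.
rewrite -(fineK (path_length_fin g a b t' t at'_ t't tb lb)) lee_fin -h.
by rewrite enorm_distC; lra.
Qed.

Lemma arc_length_param0 {R : realType} {n : nat} (g : R -> 'rV[R]_n)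
    (a b : R) : a <= b -> {within `[a, b], continuous g} ->
  (path_length g a b < +oo)%E -> arc_length_param g a b 0 = g a.
Proof.
move=> ab cg lb.
have [|t [/andP[at_ tb] t0 ->]] := arc_length_paramP g a b 0 ab cg lb.
  by rewrite lexx fine_ge0// path_length_ge0.
apply/eqP; rewrite -subr_eq0 -enorm_eq0 eq_le enorm_ge0 andbT.
by rewrite -lee_fin -t0 path_length_chord.
Qed.

Lemma arc_length_param_end {R : realType} {n : nat} (g : R -> 'rV[R]_n)
    (a b : R) : a <= b -> {within `[a, b], continuous g} ->
  (path_length g a b < +oo)%E ->
  arc_length_param g a b (fine (path_length g a b)) = g b.
Proof.
move=> ab cg lb.
have [|t [/andP[at_ tb] t0 ->]] :=
    arc_length_paramP g a b (fine (path_length g a b)) ab cg lb.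
  by rewrite lexx fine_ge0// path_length_ge0.
apply/eqP; rewrite -subr_eq0 -enorm_eq0 eq_le enorm_ge0 andbT.
have := fine_path_lengthB g a b t b at_ tb (lexx b) lb.
rewrite t0 /= subrr => h; rewrite h -lee_fin enorm_distC fineK.
  exact: path_length_chord.
exact: (path_length_fin g a b).
Qed.

(** * Integrals along the normal representation *)

Lemma arc_length_param_in {R : realType} {n : nat} (D : set 'rV[R]_n)
    (x y : 'rV[R]_n) (g : R -> 'rV[R]_n) (a b s : R) :
  rectifiable_path D x y g a b -> 0 <= s <= fine (path_length g a b) ->
  D (arc_length_param g a b s).
Proof.
move=> [ab cg gD _ lb] sl.
have [t [tab _ ->]] := arc_length_paramP g a b s ab cg lb sl.
by apply: gD; exists t => //=; rewrite in_itv.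
Qed.

Lemma bdist_arc_continuous {R : realType} {n : nat} (D : set 'rV[R]_n)
    (x y : 'rV[R]_n) (g : R -> 'rV[R]_n) (a b : R) :
  proper_subdomain D -> rectifiable_path D x y g a b ->
  {within `[0, fine (path_length g a b)],
    continuous (fun s => bdist D (arc_length_param g a b s))}.
Proof.
move=> hD [ab cg gD _ lb].
apply: (continuous_within_dominated _ _ idfun).
  by apply: continuous_subspaceT => t; exact: cvg_id.
move=> s t; rewrite /= !in_itv/= => /andP[s0 sl] /andP[t0 tl].
apply: (le_trans (bdist_norm_lipschitz D _ _ hD)).
have [st|/ltW ts] := leP s t.
  by rewrite enorm_distC distrC [leRHS]ger0_norm ?subr_ge0// arc_length_param_lipschitz.
by rewrite ger0_norm ?subr_ge0// arc_length_param_lipschitz.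
Qed.

Lemma bdistV_arc_continuous {R : realType} {n : nat} (D : set 'rV[R]_n)
    (x y : 'rV[R]_n) (g : R -> 'rV[R]_n) (a b : R) :
  proper_subdomain D -> rectifiable_path D x y g a b ->
  {within `[0, fine (path_length g a b)],
    continuous (fun s => (bdist D (arc_length_param g a b s))^-1)}.
Proof.
move=> hD hg; have ch := bdist_arc_continuous D x y g a b hD hg.
apply/subspace_continuousP => s sl.
move/subspace_continuousP : ch => /(_ s sl) ch.
apply: cvgV => //; rewrite gt_eqF// bdist_gt0//.
by apply: (arc_length_param_in D x y) => //; move: sl; rewrite /= in_itv.
Qed.

Lemma m_density_arc_continuous {R : realType} {n : nat} (D : set 'rV[R]_n)
    (x y : 'rV[R]_n) (g : R -> 'rV[R]_n) (a b : R) : (0 < n)%N ->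
  proper_subdomain D -> rectifiable_path D x y g a b ->
  {within `[0, fine (path_length g a b)],
    continuous (fun s => m_density D (arc_length_param g a b s))}.
Proof.
move=> n0 hD hg; have [bD|nbD] := pselect (bounded_set D); last first.
  have -> : m_density D = (fun z => (bdist D z)^-1).
    by apply/funext => z; rewrite /m_density asboolF.
  exact: bdistV_arc_continuous hg.
have -> : m_density D = (fun z => fine (diameter D) /
    (bdist D z * (fine (diameter D) - bdist D z))).
  by apply/funext => z; rewrite /m_density asboolT.
have ch := bdist_arc_continuous D x y g a b hD hg.
apply/subspace_continuousP => s sl.
have Ds : D (arc_length_param g a b s).
  by apply: (arc_length_param_in D x y) => //; move: sl; rewrite /= in_itv.
move/subspace_continuousP : ch => /(_ s sl) ch.
have h0 := bdist_gt0 D _ hD Ds.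
have hd := bdist_le_diameter D _ n0 hD bD Ds.
apply: cvgM; first exact: cvg_cst.
apply: cvgV; first by rewrite mulf_neq0// gt_eqF//; lra.
by apply: cvgM => //; apply: cvgB => //; exact: cvg_cst.
Qed.

Lemma measurable_within {R : realType} (f : R -> R) (p q : R) :
  {within `[p, q], continuous f} ->
  measurable_fun `[p, q] (EFin \o f).
Proof.
by move=> cf; apply/measurable_EFinP; exact: subspace_continuous_measurable_fun.
Qed.

(** * Uniform domains satisfy m <= c1 j *)

Lemma integral_log {R : realType} (l p q : R) : 0 <= l -> 0 < p -> 0 < q ->
  (\int[lebesgue_measure]_(s in `[0%R, l])
      ((p + s)^-1 + (q + (l - s))^-1)%:E)%E =
  (ln (1 + l / p) + ln (1 + l / q))%:E.
Proof.
rewrite le_eqVlt => /predU1P[<- p0 q0|l0 p0 q0].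
  by rewrite set_itv1 integral_set1 !mul0r addr0 ln1 addr0.
pose F (s : R) := ln (p + s) - ln (q + (l - s)).
have dF (s : R) : 0 <= s -> s <= l ->
    is_derive s 1 F ((p + s)^-1 + (q + (l - s))^-1).
  move=> s0 sl.
  have ps : 0 < p + s by lra.
  have qs : 0 < q + (l - s) by lra.
  have d1 : is_derive s 1 (fun s => p + s) 1.
    by have := is_deriveD (is_derive_cst p s 1) (is_derive_id s 1); rewrite add0r.
  have d2 : is_derive s 1 (fun s => q + (l - s)) (-1).
    have := is_deriveD (is_derive_cst q s 1)
      (is_deriveB (is_derive_cst l s 1) (is_derive_id s 1)).
    by rewrite !add0r.
  have e1 := @is_derive1_comp _ (@ln R) (fun s => p + s) s _ _ (@is_derive1_ln R _ ps) d1.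
  have e2 := @is_derive1_comp _ (@ln R) (fun s => q + (l - s)) s _ _ (@is_derive1_ln R _ qs) d2.
  have := is_deriveB e1 e2.
  by rewrite mulr1 mulrN1 opprK.
have cF (s : R) : 0 <= s -> s <= l -> {for s, continuous F}.
  move=> s0 sl; apply: differentiable_continuous; apply/derivable1_diffP.
  by have [] := dF s s0 sl.
rewrite (@continuous_FTC2 _ _ F)//.
- rewrite /F subrr subr0 !addr0 -EFinB; congr EFin.
  have -> : 1 + l / p = (p + l) / p by field; rewrite gt_eqF.
  have -> : 1 + l / q = (q + l) / q by field; rewrite gt_eqF.
  by rewrite !ln_div ?posrE//; lra.
- apply/subspace_continuousP => s; rewrite /= in_itv/= => /andP[s0 sl].
  apply: cvg_within_filter; apply: cvgD; apply: cvgV.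
  + by rewrite gt_eqF//; lra.
  + by apply: cvgD; [exact: cvg_cst|exact: cvg_id].
  + by rewrite gt_eqF//; lra.
  + apply: cvgD; [exact: cvg_cst|apply: cvgB; [exact: cvg_cst|exact: cvg_id]].
- split.
  + move=> s; rewrite in_itv/= => /andP[s0 sl].
    by have [] := dF s (ltW s0) (ltW sl).
  + by apply: cvg_at_right_filter; apply: cF; rewrite ?lexx ?ltW.
  + by apply: cvg_at_left_filter; apply: cF; rewrite ?lexx ?ltW.
- move=> s; rewrite in_itv/= => /andP[s0 sl].
  have [_ h] := dF s (ltW s0) (ltW sl).
  by rewrite derive1E h.
Qed.

Lemma bernoulli {R : realType} (m : nat) (t : R) : 0 <= t ->
  1 + m%:R * t <= (1 + t) ^+ m.
Proof.
move=> t0; elim: m => [|m IH]; first by rewrite mul0r addr0 expr0.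
have := ler0n R m; rewrite exprS -natr1; nra.
Qed.

Lemma ln_bernoulli {R : realType} (m : nat) (t : R) : 0 <= t ->
  ln (1 + m%:R * t) <= m%:R * ln (1 + t).
Proof.
move=> t0; rewrite [leRHS]mulr_natl -lnXn; last by lra.
rewrite ler_ln ?posrE ?exprn_gt0 ?bernoulli//; last by lra.
by have : 0 <= m%:R * t by [rewrite mulr_ge0]; lra.
Qed.

(** At arc length s from x along a path of length l that satisfies the first
    condition of uniformity, (1 + 2 c) delta >= min (delta(x) + s,
    delta(y) + l - s), so that 1/delta is at most 1 + 2 c times the sum of the two
    inverses. *)
Lemma line_integral_le_log {R : realType} {n : nat} (D : set 'rV[R]_n)
    (x y : 'rV[R]_n) (g : R -> 'rV[R]_n) (a b c : R) : (0 < n)%N -> 1 <= c ->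
  proper_subdomain D -> rectifiable_path D x y g a b ->
  (forall t, t \in `[a, b] ->
     (mine (path_length g a t) (path_length g t b) <= (c * bdist D (g t))%:E)%E) ->
  (line_integral (m_density D) g a b <=
     (2 * (1 + 2 * c) * (ln (1 + fine (path_length g a b) / bdist D x) +
                     ln (1 + fine (path_length g a b) / bdist D y)))%:E)%E.
Proof.
move=> n0 c1 hD hg hmin; have [ab cg gD [gax gby] lb] := hg.
have Dx : D x by rewrite -gax; apply: gD; exists a => //=; rewrite in_itv/= lexx.
have Dy : D y by rewrite -gby; apply: gD; exists b => //=; rewrite in_itv/= lexx andbT.
have dx := bdist_gt0 D x hD Dx; have dy := bdist_gt0 D y hD Dy.
have l0 : 0 <= fine (path_length g a b) by rewrite fine_ge0 ?path_length_ge0.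
rewrite EFinM -integral_log// -ge0_integralZl//=; last 3 first.
- apply: measurable_within; apply/subspace_continuousP => s.
  rewrite /= in_itv/= => /andP[s0 sl].
  apply: cvg_within_filter; apply: cvgD; apply: cvgV.
  + by rewrite gt_eqF//; lra.
  + by apply: cvgD; [exact: cvg_cst|exact: cvg_id].
  + by rewrite gt_eqF//; lra.
  + by apply: cvgD; [exact: cvg_cst|apply: cvgB; [exact: cvg_cst|exact: cvg_id]].
- move=> s; rewrite /= in_itv/= => /andP[s0 sl].
  by rewrite lee_fin addr_ge0// invr_ge0; lra.
- by rewrite lee_fin; lra.
rewrite /line_integral; apply: ge0_le_integral => //=.
- move=> s; rewrite in_itv/= => sl.
  have Ds := arc_length_param_in D x y g a b s hg sl.
  have /andP[h _] := m_density_bounds D _ n0 hD Ds.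
  by rewrite lee_fin (le_trans _ h)// invr_ge0 ltW// bdist_gt0.
- by apply: measurable_within; exact: m_density_arc_continuous hg.
- apply: (measurable_within (fun s => 2 * (1 + 2 * c) *
    ((bdist D x + s)^-1 + (bdist D y + (fine (path_length g a b) - s))^-1))).
  apply/subspace_continuousP => s.
  rewrite /= in_itv/= => /andP[s0 sl].
  apply: cvg_within_filter; apply: cvgM; first exact: cvg_cst.
  apply: cvgD; apply: cvgV.
  + by rewrite gt_eqF//; lra.
  + by apply: cvgD; [exact: cvg_cst|exact: cvg_id].
  + by rewrite gt_eqF//; lra.
  + by apply: cvgD; [exact: cvg_cst|apply: cvgB; [exact: cvg_cst|exact: cvg_id]].
move=> s; rewrite in_itv/= => sl; have /andP[s0 sl'] := sl.
have Ds := arc_length_param_in D x y g a b s hg sl.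
have /andP[_ h] := m_density_bounds D _ n0 hD Ds.
rewrite -EFinM lee_fin; apply: (le_trans h) => {h}.
have ds := bdist_gt0 D _ hD Ds.
rewrite -mulrA ler_pM2l//.
have [t [/andP[at_ tb] ts gs]] := arc_length_paramP g a b s ab cg lb sl.
rewrite gs in ds *.
have tsb : path_length g t b = (fine (path_length g a b) - s)%:E.
  rewrite -[s]/(fine s%:E) -ts (fine_path_lengthB g a b)// fineK//.
  exact: (path_length_fin g a b).
have hx : bdist D x <= bdist D (g t) + s.
  apply: (le_trans (bdist_lipschitz D x (g t) hD)); rewrite lerD2l.
  by rewrite -lee_fin -ts enorm_distC -gax path_length_chord.
have hy : bdist D y <= bdist D (g t) + (fine (path_length g a b) - s).
  apply: (le_trans (bdist_lipschitz D y (g t) hD)); rewrite lerD2l.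
  by rewrite -lee_fin -tsb -gby path_length_chord.
have px : 0 < (bdist D x + s)^-1 by rewrite invr_gt0; lra.
have py : 0 < (bdist D y + (fine (path_length g a b) - s))^-1 by rewrite invr_gt0; lra.
have inv_le (p : R) : 0 < p -> p <= (1 + 2 * c) * bdist D (g t) ->
    (bdist D (g t))^-1 <= (1 + 2 * c) * p^-1.
  by move=> p0 hp; rewrite ler_pdivlMr// mulrC ler_pdivrMr.
have : t \in `[a, b] by rewrite in_itv/= at_ tb.
move=> /hmin; rewrite ts tsb -EFin_min lee_fin ge_min => /orP[h|h].
  apply: (@le_trans _ _ ((1 + 2 * c) * (bdist D x + s)^-1)).
    by apply: inv_le; lra.
  by rewrite ler_wpM2l; lra.
apply: (@le_trans _ _ ((1 + 2 * c) *
    (bdist D y + (fine (path_length g a b) - s))^-1)).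
  by apply: inv_le; lra.
by rewrite ler_wpM2l; lra.
Qed.

Lemma uniform_m_le_j {R : realType} {n : nat} (D : set 'rV[R]_n) :
  (0 < n)%N -> proper_subdomain D -> uniform_domain D ->
  exists2 c1 : R, 1 <= c1 &
    forall x y : 'rV[R]_n, D x -> D y ->
      (m_metric D x y <= (c1 * j_metric D x y)%:E)%E.
Proof.
move=> n0 hD [c c1 H].
pose m := (Num.truncn c).+1.
have cm : c <= m%:R by rewrite ltW// truncnS_gt.
exists (2 * (1 + 2 * c) * (2 * m%:R)).
  by have : 1 <= m%:R :> R by [rewrite ler1n]; nra.
move=> x y Dx Dy.
have [g [a [b [[hg _] hmin hlen]]]] := H x y Dx Dy.
have [ab _ _ _ lb] := hg.
have dx := bdist_gt0 D x hD Dx; have dy := bdist_gt0 D y hD Dy.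
apply: (@le_trans _ _ (line_integral (m_density D) g a b)).
  by apply: ereal_inf_lbound; exists g, a, b.
apply: (le_trans (line_integral_le_log D x y g a b c n0 c1 hD hg hmin)).
rewrite lee_fin -mulrA -[leRHS]mulrA -[leRHS]mulrA ler_pM2l// ler_wpM2l//; first by lra.
have d0 := enorm_ge0 (x - y).
have l0 : 0 <= fine (path_length g a b) by rewrite fine_ge0 ?path_length_ge0.
have ld : fine (path_length g a b) <= m%:R * enorm (x - y).
  rewrite -lee_fin fineK; last exact: (path_length_fin g a b).
  by apply: (le_trans hlen); rewrite lee_fin ler_wpM2r.
have key z : 0 < bdist D z -> ln (1 + fine (path_length g a b) / bdist D z) <=
    m%:R * ln (1 + enorm (x - y) / bdist D z).
  move=> dz; apply: le_trans (ln_bernoulli m _ (divr_ge0 d0 (ltW dz))).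
  have q0 : 0 <= fine (path_length g a b) / bdist D z by rewrite divr_ge0// ltW.
  have q1 : fine (path_length g a b) / bdist D z <=
      m%:R * (enorm (x - y) / bdist D z).
    by rewrite mulrA ler_wpM2r// invr_ge0 ltW.
  by rewrite ler_ln ?posrE; lra.
have p z : 0 < bdist D z -> 0 < 1 + enorm (x - y) / bdist D z.
  by move=> dz; rewrite ltr_wpDr// divr_ge0// ltW.
rewrite /j_metric lnM ?posrE ?p//.
have := key x dx; have := key y dy; lra.
Qed.

(** * A length estimate for discrete chains *)

(** [r l] stands for the distance to the boundary of the l-th vertex of a chain
    and [e l] for the length of its l-th edge.  The last clause says that a
    subchain along which r is comparable to rho has at most C edges. *)
Definition quasi_chain {R : realType} (r e : nat -> R) (N C : nat) : Prop :=
  [/\ forall l, (l <= N)%N -> 0 < r l,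
      forall l, (l < N)%N -> [/\ 0 <= e l, e l <= r l & e l <= r l.+1],
      forall l, (l < N)%N -> r l.+1 <= 2 * r l /\ r l <= 2 * r l.+1 &
      forall i k rho, (i <= k)%N -> (k <= N)%N -> 0 < rho ->
        (forall l, (i <= l)%N -> (l <= k)%N -> r l <= 2 * rho) ->
        rho / 2 <= r i -> rho / 2 <= r k -> (k - i <= C)%N].

Lemma quasi_chain_rev {R : realType} (r e : nat -> R) (N C : nat) :
  quasi_chain r e N C ->
  quasi_chain (fun l => r (N - l)%N) (fun l => e (N - l.+1)%N) N C.
Proof.
move=> [r0 he hr hC]; split.
- by move=> l _; apply: r0; exact: leq_subr.
- move=> l lN; have [|h1 h2 h3] := he (N - l.+1)%N; first by lia.
  by have -> : (N - l = (N - l.+1).+1)%N by lia.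
- move=> l lN; have [|h1 h2] := hr (N - l.+1)%N; first by lia.
  by have -> : (N - l = (N - l.+1).+1)%N by lia.
- move=> i k rho ik kN rho0 hrho hi hk.
  have -> : (k - i = (N - i) - (N - k))%N by lia.
  apply: (hC _ _ rho) => //; try lia.
  move=> l l1 l2; have -> : (l = N - (N - l))%N by lia.
  by apply: hrho; lia.
Qed.

Lemma doubling_iter {R : realType} (r : nat -> R) (N i k : nat) :
  (forall l, (l < N)%N -> r l.+1 <= 2 * r l) -> (i + k <= N)%N ->
  r (i + k)%N <= 2 ^+ k * r i.
Proof.
move=> h; elim: k => [|k IH] ikN; first by rewrite addn0 expr0 mul1r.
rewrite addnS exprS -mulrA (le_trans (h _ _))//; first by rewrite -addnS.
by rewrite ler_pM2l// IH//; lia.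
Qed.

Lemma exists_max_le {R : realType} (r : nat -> R) (i : nat) :
  exists2 a, (a <= i)%N & forall l, (l <= i)%N -> r l <= r a.
Proof.
elim: i => [|i [a ai ha]].
  by exists 0%N => // l; rewrite leqn0 => /eqP ->.
have [h|h] := leP (r i.+1) (r a).
  exists a; first exact: leqW.
  by move=> l; rewrite leq_eqVlt => /predU1P[->//|]; exact: ha.
exists i.+1 => // l; rewrite leq_eqVlt => /predU1P[->//|li].
by rewrite (le_trans (ha l li))// ltW.
Qed.

Lemma sum_nat_split {R : realType} (e : nat -> R) (u v w : nat) :
  (u <= v)%N -> (v <= w)%N ->
  \sum_(u <= l < w) e l = \sum_(u <= l < v) e l + \sum_(v <= l < w) e l.
Proof. by move=> uv vw; rewrite (big_cat_nat uv vw). Qed.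

Lemma sum_nat_le {R : realType} (e : nat -> R) (i k : nat) (B : R) :
  (i <= k)%N -> (forall l, (i <= l)%N -> (l < k)%N -> e l <= B) ->
  \sum_(i <= l < k) e l <= (k - i)%:R * B.
Proof.
move=> ik h; rewrite mulr_natl -sumr_const_nat.
by apply: ler_sum_nat => l /andP[]; exact: h.
Qed.

(** As long as r has not yet reached its peak r q, the length of the chain up to
    the vertex i is controlled by the running maximum rho of r, and r i is not
    much smaller than rho.  Indeed, if p is the first vertex where r exceeds
    rho / 2 and q0 the first one from i on where r is at least rho, there are at
    most C edges between p and q0, and the length up to p is estimated by
    induction with rho / 2 in place of rho. *)
Lemma length_before_peak {R : realType} (r e : nat -> R) (N C : nat) :
  quasi_chain r e N C ->
  forall i q, (i <= q)%N -> (q <= N)%N ->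
  (forall l, (l <= i)%N -> r l <= r q) ->
  (forall M, (forall l, (l <= i)%N -> r l <= M) ->
     \sum_(0 <= l < i) e l <= (1 + 2 * C%:R) * M) /\
  (forall l, (l <= i)%N -> r l <= 2 ^+ C * r i).
Proof.
move=> [r0 he hr hC] i; elim/ltn_ind: i => i IH q iq qN hq.
have [a ai ha] := exists_max_le r i.
have rho0 : 0 < r a by apply: r0; lia.
have exq : exists k, (i <= k)%N && (r a <= r k) by exists q; rewrite iq hq.
case: (ex_minnP exq) => q0 /andP[iq0 raq0] q0min.
have q0q : (q0 <= q)%N by apply: q0min; rewrite iq hq.
have exp : exists k, r a / 2 <= r k by exists a; lra.
case: (ex_minnP exp) => p hp pmin.
have pa : (p <= a)%N by apply: pmin; lra.
have lt_q0 l : (i <= l)%N -> (l < q0)%N -> r l < r a.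
  move=> il lq0; rewrite ltNge; apply/negP => h.
  by have := q0min l; rewrite il h => /(_ isT); lia.
have lt_p l : (l < p)%N -> r l < r a / 2.
  move=> lp; rewrite ltNge; apply/negP => h.
  by have := pmin l h; lia.
have rq0 : r q0 <= 2 * r a.
  have [q0i|iq0'] := leqP q0 i; first by have := ha q0 q0i; lra.
  case: q0 => [//|q0] in iq0 raq0 q0min q0q lt_q0 iq0' *.
  have [|h _] := hr q0; first by lia.
  have := lt_q0 q0 iq0' (ltnSn _); lra.
have gap : (q0 - p <= C)%N.
  apply: (hC _ _ (r a)) => //; try lia; last by lra.
  move=> l pl lq0; have [li|il] := leqP l i; first by have := ha l li; lra.
  move: lq0; rewrite leq_eqVlt => /predU1P[->//|lq0].
  by have := lt_q0 l (ltnW il) lq0; lra.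
split; last first.
  move=> l li; apply: (le_trans (ha l li)); apply: (le_trans raq0).
  have -> : q0 = (i + (q0 - i))%N by lia.
  apply: (@le_trans _ _ (2 ^+ (q0 - i) * r i)).
    by apply: (doubling_iter r N) => [l' /hr[]//|]; lia.
  rewrite ler_pM2r; last by apply: r0; lia.
  by rewrite ler_eXn2l ?ltr1n//; lia.
move=> M hM; apply: (@le_trans _ _ ((1 + 2 * C%:R) * r a)); last first.
  by rewrite ler_wpM2l ?hM//; have := ler0n R C; lra.
rewrite (sum_nat_split e 0 p i) ?(leq_trans pa ai)//.
have part2 : \sum_(p <= l < i) e l <= C%:R * r a.
  apply: (@le_trans _ _ ((i - p)%:R * r a)).
    apply: sum_nat_le; first by lia.
    move=> l pl li; have [|_ h _] := he l; first by lia.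
    by apply: (le_trans h); apply: ha; lia.
  by rewrite ler_pM2r// ler_nat; lia.
suff part1 : \sum_(0 <= l < p) e l <= (1 + 2 * C%:R) * (r a / 2) + r a / 2.
  by lra.
case: p => [|p] in hp pmin pa lt_p gap part2 *.
  by rewrite big_nil; have := mulr_ge0 (ler0n R C) (ltW rho0); lra.
rewrite big_nat_recr//=; apply: lerD; last first.
  have [|_ h _] := he p; first by lia.
  by apply: (le_trans h); apply: ltW; apply: lt_p.
have [||//||h _] := IH p _ q; [lia|lia| |].
  by move=> l lp; apply: hq; lia.
by apply: h => l lp; apply: ltW; apply: lt_p; lia.
Qed.

Lemma length_after_peak {R : realType} (r e : nat -> R) (N C : nat) :
  quasi_chain r e N C ->
  forall i q, (q <= i)%N -> (i <= N)%N ->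
  (forall l, (i <= l)%N -> (l <= N)%N -> r l <= r q) ->
  (forall M, (forall l, (i <= l)%N -> (l <= N)%N -> r l <= M) ->
     \sum_(i <= l < N) e l <= (1 + 2 * C%:R) * M) /\
  (forall l, (i <= l)%N -> (l <= N)%N -> r l <= 2 ^+ C * r i).
Proof.
move=> /quasi_chain_rev hqc i q qi iN hq.
have [||l li|h1 h2] := length_before_peak _ _ _ _ hqc (N - i)%N (N - q)%N.
- by lia.
- by lia.
- by rewrite (subKn (leq_trans qi iN)); apply: hq; lia.
split=> [M hM|l il lN]; last first.
  have := h2 (N - l)%N; rewrite (subKn iN) (subKn lN); apply; lia.
have -> : \sum_(i <= l < N) e l = \sum_(0 <= l < N - i) e (N - l.+1)%N.
  rewrite big_nat_rev/= -{1}[i]add0n big_addn; apply: eq_big_nat => l /andP[_ lN].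
  by congr (e _); lia.
by apply: h1 => l li; apply: hM; lia.
Qed.

(** Both estimates, with the peak at an index where r is maximal. *)
Lemma quasi_chain_peak {R : realType} (r e : nat -> R) (N C : nat) :
  quasi_chain r e N C -> exists2 M, (M <= N)%N &
  (forall i, (i <= M)%N ->
     \sum_(0 <= l < i) e l <= (1 + 2 * C%:R) * 2 ^+ C * r i) /\
  (forall i, (M <= i)%N -> (i <= N)%N ->
     \sum_(i <= l < N) e l <= (1 + 2 * C%:R) * 2 ^+ C * r i).
Proof.
move=> hqc; have [M MN hM] := exists_max_le r N; exists M => //; split.
- move=> i iM.
  have [l li|h1 h2] := length_before_peak _ _ _ _ hqc i M iM MN.
    by apply: hM; lia.
  by rewrite -mulrA; exact: h1.
- move=> i Mi iN.
  have [l il lN|h1 h2] := length_after_peak _ _ _ _ hqc i M Mi iN.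
    by apply: hM.
  by rewrite -mulrA; exact: h1.
Qed.

(** The total length: a chain whose ends have r at most 2 d has length comparable
    to d as soon as its part between the first and the last vertex with r at
    least d has a bounded number of edges. *)
Lemma quasi_chain_length {R : realType} (r e : nat -> R) (N C C2 : nat) (d : R) :
  quasi_chain r e N C -> 0 < d -> r 0%N <= 2 * d -> r N <= 2 * d ->
  (forall u v, (u <= v)%N -> (v <= N)%N -> d <= r u -> d <= r v ->
     \sum_(0 <= l < u) e l <= 2 * (1 + 2 * C%:R) * d ->
     \sum_(v <= l < N) e l <= 2 * (1 + 2 * C%:R) * d -> (v - u <= C2)%N) ->
  \sum_(0 <= l < N) e l <=
    (4 * (1 + 2 * C%:R) + C2%:R * (2 * 2 ^+ C2)) * d.
Proof.
move=> hqc d0 r0d rNd H.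
have [r0 he hr hC] := hqc.
have [M MN hM] := exists_max_le r N.
have C0 := ler0n R C; have C20 := ler0n R C2.
have C2p : 0 <= C2%:R * (2 * 2 ^+ C2) :> R by rewrite !mulr_ge0.
have [rMd|dM] := ltP (r M) d.
  have [l lM|h1 _] := length_before_peak _ _ _ _ hqc M M (leqnn M) MN.
    by apply: hM; lia.
  have [l lM lN|h2 _] := length_after_peak _ _ _ _ hqc M M (leqnn M) MN.
    by apply: hM; lia.
  have {}h1 : \sum_(0 <= l < M) e l <= (1 + 2 * C%:R) * d.
    by apply: h1 => l lM; apply: (le_trans (hM l _)); [lia|exact: ltW].
  have {}h2 : \sum_(M <= l < N) e l <= (1 + 2 * C%:R) * d.
    by apply: h2 => l _ lN; apply: (le_trans (hM l lN)); exact: ltW.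
  rewrite (sum_nat_split e 0 M N)//.
  by have := mulr_ge0 C2p (ltW d0); have := mulr_ge0 C0 (ltW d0); lra.
have exu : exists k, d <= r k by exists M.
case: (ex_minnP exu) => u du umin.
have exv : exists k, (k <= N)%N && (d <= r k) by exists M; rewrite MN.
have ubv k : (k <= N)%N && (d <= r k) -> (k <= N)%N by case/andP.
case: (ex_maxnP exv ubv) => v /andP[vN dv] vmax.
have uM : (u <= M)%N by apply: umin.
have Mv : (M <= v)%N by apply: vmax; rewrite MN.
have lt_u l : (l < u)%N -> r l < d.
  by move=> lu; rewrite ltNge; apply/negP => /umin; lia.
have gt_v l : (v < l)%N -> (l <= N)%N -> r l < d.
  move=> vl lN; rewrite ltNge; apply/negP => h.
  by have := vmax l; rewrite lN h leqNgt vl => /(_ isT).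
have ru : r u <= 2 * d.
  case: u => [//|u] in du umin uM lt_u *.
  have [|h _] := hr u; first by lia.
  by have := lt_u u (ltnSn u); lra.
have rv : r v <= 2 * d.
  move: (vN); rewrite leq_eqVlt => /predU1P[->//|vN'].
  have [_ h] := hr v vN'.
  by have := gt_v v.+1 (ltnSn v) vN'; lra.
have Su : \sum_(0 <= l < u) e l <= 2 * (1 + 2 * C%:R) * d.
  have [l lu|h _] := length_before_peak _ _ _ _ hqc u M uM MN.
    by apply: hM; exact: leq_trans lu (leq_trans uM MN).
  rewrite [X in X * d]mulrC -mulrA; apply: h => l.
  rewrite leq_eqVlt => /predU1P[->//|lu].
  by have := lt_u l lu; lra.
have Sv : \sum_(v <= l < N) e l <= 2 * (1 + 2 * C%:R) * d.
  have [l lu lN|h _] := length_after_peak _ _ _ _ hqc v M Mv vN.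
    exact: hM.
  rewrite [X in X * d]mulrC -mulrA; apply: h => l.
  rewrite leq_eqVlt => /predU1P[<-//|vl] lN.
  by have := gt_v l vl lN; lra.
have uv : (u <= v)%N := leq_trans uM Mv.
have gap := H u v uv vN du dv Su Sv.
have Suv : \sum_(u <= l < v) e l <= C2%:R * (2 * 2 ^+ C2) * d.
  apply: (@le_trans _ _ ((v - u)%:R * (2 * 2 ^+ C2 * d))).
    apply: sum_nat_le => // l ul lv.
    have [|_ h _] := he l; first exact: leq_trans lv vN.
    apply: (le_trans h).
    have -> : l = (u + (l - u))%N by rewrite subnKC.
    apply: (@le_trans _ _ (2 ^+ (l - u) * r u)).
      apply: (doubling_iter r N) => [l' /hr[]//|].
      by rewrite subnKC//; exact: leq_trans (ltnW lv) vN.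
    rewrite [2 * _]mulrC -mulrA; apply: ler_pM => //.
    - by rewrite ltW// r0//; exact: leq_trans uv vN.
    - by rewrite ler_eXn2l ?ltr1n// (leq_trans _ gap)// leq_sub2r// ltnW.
  rewrite -[leRHS]mulrA ler_wpM2r// ?ler_nat//.
  by rewrite !mulr_ge0// ltW.
rewrite (sum_nat_split e 0 u N) ?(leq_trans uv)//.
by rewrite (sum_nat_split e u v N)//; lra.
Qed.

(** * Chains of admissible steps *)

(** The segment [u, v] lies in D and is no longer than the distance of any of
    its points to the boundary.  Subsegments of admissible segments are
    admissible, which is what makes shortest chains injective. *)
Definition admissible {R : realType} {n : nat} (D : set 'rV[R]_n)
    (u v : 'rV[R]_n) : Prop :=
  forall t : R, 0 <= t <= 1 ->
    D (u + t *: (v - u)) /\ enorm (v - u) <= bdist D (u + t *: (v - u)).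

Lemma admissible_sub {R : realType} {n : nat} (D : set 'rV[R]_n)
    (u v : 'rV[R]_n) (s t : R) : admissible D u v -> 0 <= s <= 1 ->
  0 <= t <= 1 -> admissible D (u + s *: (v - u)) (u + t *: (v - u)).
Proof.
move=> uv s01 t01 k k01.
have E : u + t *: (v - u) - (u + s *: (v - u)) = (t - s) *: (v - u).
  by rewrite opprD addrACA subrr add0r -scalerBl.
have -> : u + s *: (v - u) + k *: (u + t *: (v - u) - (u + s *: (v - u))) =
    u + (s + k * (t - s)) *: (v - u).
  by rewrite E scalerA -addrA -scalerDl.
have [|Dw hw] := uv (s + k * (t - s)); first by nra.
split => //; rewrite E enormZ; apply: le_trans hw.
by rewrite ler_piMl ?enorm_ge0// ler_norml; lra.
Qed.

Lemma admissible_sym {R : realType} {n : nat} (D : set 'rV[R]_n)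
    (u v : 'rV[R]_n) : admissible D u v -> admissible D v u.
Proof.
move=> uv; have := admissible_sub D u v 1 0 uv.
by rewrite scale0r scale1r addr0 addrC subrK; apply; rewrite ?lexx ler01.
Qed.

Lemma admissible_near {R : realType} {n : nat} (D : set 'rV[R]_n)
    (x y : 'rV[R]_n) : proper_subdomain D -> D x ->
  enorm (y - x) <= bdist D x / 2 -> admissible D x y.
Proof.
move=> hD Dx xy t t01; have dx := bdist_gt0 D x hD Dx.
have tx : enorm (x + t *: (y - x) - x) <= bdist D x / 2.
  rewrite addrC addKr enormZ ger0_norm; last by lra.
  by apply: le_trans xy; rewrite ler_piMl ?enorm_ge0//; lra.
split.
  by apply: (ball_bdist_sub D x) => //; lra.
have := bdist_lipschitz D x (x + t *: (y - x)) hD.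
rewrite [enorm (x - _)]enorm_distC; lra.
Qed.

Lemma admissible_bounds {R : realType} {n : nat} (D : set 'rV[R]_n)
    (u v : 'rV[R]_n) : admissible D u v ->
  [/\ D u, D v, enorm (v - u) <= bdist D u & enorm (v - u) <= bdist D v].
Proof.
move=> uv; have [|Du hu] := uv 0; first by rewrite lexx ler01.
have [|Dv hv] := uv 1; first by rewrite lexx ler01.
move: Du hu Dv hv; rewrite scale0r scale1r addr0.
by rewrite [u + _]addrC subrK.
Qed.

(** v can be reached from u by N admissible steps. *)
Fixpoint reach {R : realType} {n : nat} (D : set 'rV[R]_n) (N : nat)
    (u v : 'rV[R]_n) : Prop :=
  if N is M.+1 then exists2 w, admissible D u w & reach D M w v else u = v.

Lemma reach1 {R : realType} {n : nat} (D : set 'rV[R]_n) (u v : 'rV[R]_n) :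
  admissible D u v -> reach D 1 u v.
Proof. by move=> uv; exists v. Qed.

Lemma reach_cat {R : realType} {n : nat} (D : set 'rV[R]_n) (M N : nat)
    (u v w : 'rV[R]_n) : reach D M u v -> reach D N v w -> reach D (M + N) u w.
Proof.
elim: M u => [|M IH] u /=; first by move=> ->.
by move=> [u' uu' u'v] vw; exists u' => //; exact: IH.
Qed.

Lemma reach_seq {R : realType} {n : nat} (D : set 'rV[R]_n) (N : nat)
    (u v : 'rV[R]_n) : reach D N u v ->
  exists f : nat -> 'rV[R]_n, [/\ f 0%N = u, f N = v &
    forall l, (l < N)%N -> admissible D (f l) (f l.+1)].
Proof.
elim: N u => [|N IH] u /=; first by move=> ->; exists (fun=> v).
move=> [w uw /IH [f [f0 fN hf]]].
exists (fun l => if l is l'.+1 then f l' else u).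
split; [by []|exact: fN|].
by case=> [|l] lN; [rewrite f0|exact: hf].
Qed.

Lemma reach_sub {R : realType} {n : nat} (D : set 'rV[R]_n)
    (f : nat -> 'rV[R]_n) (i k : nat) : (i <= k)%N ->
  (forall l, (i <= l)%N -> (l < k)%N -> admissible D (f l) (f l.+1)) ->
  reach D (k - i) (f i) (f k).
Proof.
move=> ik; have [m ->] : exists m, k = (i + m)%N by exists (k - i)%N; rewrite subnKC.
rewrite addKn; elim: m i {ik} => [|m IH] i hf.
  by rewrite addn0.
exists (f i.+1); first by apply: hf; lia.
by rewrite -addSnnS; apply: IH => l il lm; apply: hf; lia.
Qed.

(** The vertices [f 0], ..., [f N] form a chain with the least possible number of
    steps between its ends; the values of f beyond N are irrelevant. *)
Definition shortest_chain {R : realType} {n : nat} (D : set 'rV[R]_n)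
    (N : nat) (f : nat -> 'rV[R]_n) : Prop :=
  (forall l, (l < N)%N -> admissible D (f l) (f l.+1)) /\
  (forall M, reach D M (f 0%N) (f N) -> (N <= M)%N).

Lemma shortest_chain_exists {R : realType} {n : nat} (D : set 'rV[R]_n)
    (x y : 'rV[R]_n) (N : nat) : reach D N x y ->
  exists M f, [/\ shortest_chain D M f, f 0%N = x & f M = y].
Proof.
move=> xy; have ex : exists M, `[< reach D M x y >] by exists N; apply/asboolP.
case: (ex_minnP ex) => M /asboolP hM Mmin.
have [f [f0 fM hf]] := reach_seq D M x y hM.
exists M, f; split => //; split => // K; rewrite f0 fM => hK.
by apply: Mmin; apply/asboolP.
Qed.

Lemma shortest_chain_sub {R : realType} {n : nat} (D : set 'rV[R]_n)
    (N : nat) (f : nat -> 'rV[R]_n) (i k M : nat) : shortest_chain D N f ->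
  (i <= k)%N -> (k <= N)%N -> reach D M (f i) (f k) -> (k - i <= M)%N.
Proof.
move=> [hf hmin] ik kN ikM.
have h1 : reach D (i - 0) (f 0%N) (f i).
  by apply: reach_sub => // l _ li; apply: hf; lia.
have h2 : reach D (N - k) (f k) (f N).
  by apply: reach_sub => // l _ li; apply: hf; lia.
have := hmin _ (reach_cat D _ _ _ _ _ (reach_cat D _ _ _ _ _ h1 ikM) h2); lia.
Qed.

(** * From the integral of 1/delta to the number of steps *)

Lemma integral_lower_split {R : realType} (h : R -> R) (p q l k : R) :
  p <= q -> q <= l -> 0 <= k -> {within `[p, l], continuous h} ->
  (forall s, p <= s <= l -> 0 <= h s) -> (forall s, p <= s < q -> k <= h s) ->
  ((k * (q - p))%:E + \int[lebesgue_measure]_(s in `[q, l]) (h s)%:E <=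
   \int[lebesgue_measure]_(s in `[p, l]) (h s)%:E)%E.
Proof.
move=> pq ql k0 ch h0 hk.
have mh : measurable_fun `[p, l] (EFin \o h) by exact: measurable_within.
have E : `[p, l]%classic = `[p, q[%classic `|` `[q, l]%classic.
  by rewrite -itv_bndbnd_setU// bnd_simp.
have sub1 : `[p, q[ `<=` `[p, l].
  by move=> s /=; rewrite !in_itv/= => /andP[ps sq]; apply/andP; split => //; lra.
rewrite [leRHS](_ : _ = \int[lebesgue_measure]_(s in `[p, q[) (h s)%:E +
    \int[lebesgue_measure]_(s in `[q, l]) (h s)%:E)%E; last first.
  rewrite E ge0_integral_setU//=.
  - by rewrite -E.
  - by move=> s hs; rewrite lee_fin h0//; move: hs; rewrite !in_itv/=; lra.
  - apply/disj_setPS => s /=; rewrite !in_itv/= => -[/andP[_ sq] /andP[qs _]].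
    by have := lt_le_trans sq qs; rewrite ltxx.
apply: leeD => //.
have -> : (k * (q - p))%:E = (\int[lebesgue_measure]_(s in `[p, q[) (cst k%:E) s)%E.
  rewrite integral_cst//= lebesgue_measure_itv/= lte_fin.
  case: ltP => // qp; have -> : q = p by lra.
  by rewrite subrr mulr0 mule0.
apply: ge0_le_integral => //=.
exact: measurable_funS mh.
Qed.

(** Advancing along the path by half the distance to the boundary is an
    admissible step and costs at least 1/3 in the integral of 1/delta. *)
Lemma reach_along_path {R : realType} {n : nat} (D : set 'rV[R]_n)
    (x y : 'rV[R]_n) (g : R -> 'rV[R]_n) (a b : R) (m : nat) (s0 : R) :
  proper_subdomain D -> rectifiable_path D x y g a b ->
  0 <= s0 <= fine (path_length g a b) ->
  (\int[lebesgue_measure]_(t in `[s0, fine (path_length g a b)])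
     ((bdist D (arc_length_param g a b t))^-1)%:E <= (m%:R / 3)%:E)%E ->
  exists2 M, (M <= m.+1)%N & reach D M (arc_length_param g a b s0) y.
Proof.
move=> hD hg; have [ab cg gD [gax gby] lb] := hg.
set l := fine (path_length g a b); set p := arc_length_param g a b.
have pl : p l = y by rewrite /p /l arc_length_param_end.
have Dp t : 0 <= t <= l -> D (p t) by exact: arc_length_param_in hg.
have lip t t' : 0 <= t -> t <= t' -> t' <= l -> enorm (p t' - p t) <= t' - t.
  by move=> *; exact: arc_length_param_lipschitz.
have cinv := bdistV_arc_continuous D x y g a b hD hg.
rewrite -/l -/p in cinv *.
have step s : 0 <= s <= l -> bdist D (p s) / 2 < l - s ->
    ((3^-1)%:E + \int[lebesgue_measure]_(t in `[(s + bdist D (p s) / 2)%R, l])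
        ((bdist D (p t))^-1)%:E <=
      \int[lebesgue_measure]_(t in `[s, l]) ((bdist D (p t))^-1)%:E)%E.
  move=> sl far; have ds := bdist_gt0 D _ hD (Dp s sl).
  have -> : 3^-1 = (3 / 2 * bdist D (p s))^-1 * (s + bdist D (p s) / 2 - s) :> R.
    by field; rewrite gt_eqF.
  apply: integral_lower_split; try lra.
  - by rewrite invr_ge0 mulr_ge0// ltW.
  - by apply: continuous_subspaceW cinv => t /=; rewrite !in_itv/=; lra.
  - by move=> t tl; rewrite invr_ge0 ltW// bdist_gt0//; apply: Dp; lra.
  - move=> t tl; have tl' : 0 <= t <= l by lra.
    have dt := bdist_gt0 D _ hD (Dp t tl').
    rewrite lef_pV2 ?posrE//; last by rewrite mulr_gt0.
    have := bdist_lipschitz D (p t) (p s) hD; have := lip s t; lra.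
elim: m s0 => [|m IH] s sl hint; have ds := bdist_gt0 D _ hD (Dp s sl);
  have [near_|far] := leP (l - s) (bdist D (p s) / 2).
- exists 1%N => //; apply/reach1/admissible_near => //; first exact: Dp.
  by rewrite -pl (le_trans _ near_)// lip//; lra.
- have := le_trans (step s sl far) hint; rewrite mul0r leNgt => /negP[].
  rewrite -[ltLHS]adde0; apply: lte_leD => //; first by rewrite lte_fin.
  apply: integral_ge0 => t; rewrite /= in_itv/= => tl.
  by rewrite lee_fin invr_ge0 ltW// bdist_gt0//; apply: Dp; lra.
- exists 1%N => //; apply/reach1/admissible_near => //; first exact: Dp.
  by rewrite -pl (le_trans _ near_)// lip//; lra.
have [||M hM sM] := IH (s + bdist D (p s) / 2).
- by lra.
- rewrite -(leeD2lE (x := (3^-1)%:E))//; apply: (le_trans (step s sl far)).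
  by apply: (le_trans hint); rewrite -EFinD lee_fin -natr1; lra.
exists M.+1 => //; exists (p (s + bdist D (p s) / 2)) => //.
apply: admissible_near => //; first exact: Dp.
by have := lip s (s + bdist D (p s) / 2); lra.
Qed.

Lemma reach_of_m_metric {R : realType} {n : nat} (D : set 'rV[R]_n)
    (x y : 'rV[R]_n) (K : R) : (0 < n)%N -> proper_subdomain D -> 0 <= K ->
  (m_metric D x y < K%:E)%E -> exists2 M, M%:R <= 3 * K + 2 & reach D M x y.
Proof.
move=> n0 hD K0 /ereal_inf_lt [_ [g [a [b [hg ->]]]] hK].
have [ab cg gD [gax gby] lb] := hg.
have l0 : 0 <= fine (path_length g a b) by rewrite fine_ge0 ?path_length_ge0.
have [||M hM xy] := reach_along_path D x y g a b (Num.truncn (3 * K)).+1 0 hD hg.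
- by rewrite lexx.
- apply: (@le_trans _ _ (line_integral (m_density D) g a b)).
    apply: ge0_le_integral => //=.
    + move=> s; rewrite in_itv/= => sl; rewrite lee_fin invr_ge0 ltW//.
      by rewrite bdist_gt0//; exact: arc_length_param_in hg sl.
    + apply: (measurable_within (fun s => (bdist D (arc_length_param g a b s))^-1)).
      exact: bdistV_arc_continuous hg.
    + apply: (measurable_within (fun s => m_density D (arc_length_param g a b s))).
      exact: m_density_arc_continuous hg.
    + move=> s; rewrite in_itv/= => sl; rewrite lee_fin.
      by have /andP[] := m_density_bounds D _ n0 hD (arc_length_param_in D x y g a b s hg sl).
  apply: (le_trans (ltW hK)); rewrite lee_fin ler_pdivlMr//.
  by rewrite mulrC ltW// truncnS_gt.
exists M; last by rewrite -gax -(arc_length_param0 g a b ab cg lb).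
have K3 : 0 <= 3 * K by rewrite mulr_ge0.
have := truncn_le (3 * K); rewrite K3 => h.
have : M%:R <= (Num.truncn (3 * K)).+2%:R :> R by rewrite ler_nat.
by rewrite -natr1 -natr1; lra.
Qed.

(** * Polygonal paths *)

(** The projection of the line onto [0, 1]. *)
Definition clamp {R : realType} (u : R) : R := Num.min 1 (Num.max 0 u).

Lemma clamp_eq0 {R : realType} (u : R) : u <= 0 -> clamp u = 0.
Proof. by move=> u0; rewrite /clamp max_l// min_r. Qed.

Lemma clamp_eq1 {R : realType} (u : R) : 1 <= u -> clamp u = 1.
Proof. by move=> u1; rewrite /clamp max_r ?min_l//; lra. Qed.

Lemma clamp_id {R : realType} (u : R) : 0 <= u <= 1 -> clamp u = u.
Proof. by move=> /andP[u0 u1]; rewrite /clamp max_r// min_r. Qed.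

Lemma clamp_homo {R : realType} (u v : R) : u <= v -> clamp u <= clamp v.
Proof.
move=> uv; rewrite /clamp le_min !ge_min lexx/=; apply/orP; right.
by rewrite ge_max !le_max lexx uv orbT.
Qed.

Lemma clamp_continuous {R : realType} : continuous (@clamp R).
Proof.
move=> u; apply: (@continuous_min R R (fun=> 1) (fun u => Num.max 0 u)).
  exact: cvg_cst.
by apply: (@continuous_max R R (fun=> 0) idfun); [exact: cvg_cst|exact: cvg_id].
Qed.

(** Sums in which the first terms are switched on one after the other as t
    grows, each one linearly during a unit of time. *)
Definition clamp_sum {R : realType} {V : lmodType R} (F : nat -> V) (N : nat)
    (t : R) : V :=
  \sum_(0 <= l < N) clamp (t - l%:R) *: F l.

Lemma clamp_sumE {R : realType} {V : lmodType R} (F : nat -> V) (N i : nat)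
    (t : R) : (i < N)%N -> i%:R <= t <= i.+1%:R ->
  clamp_sum F N t = \sum_(0 <= l < i) F l + (t - i%:R) *: F i.
Proof.
move=> iN /andP[it ti]; rewrite /clamp_sum.
rewrite (big_cat_nat (leq0n i) (ltnW iN))/=; congr (_ + _).
  apply: eq_big_nat => l /andP[_ li]; rewrite clamp_eq1 ?scale1r//.
  have : l.+1%:R <= i%:R :> R by rewrite ler_nat.
  by rewrite -natr1; lra.
rewrite big_ltn// [X in _ + X]big_nat big1 => [|l /andP[il _]].
  by rewrite addr0 clamp_id//; rewrite -natr1 in ti; lra.
rewrite clamp_eq0 ?scale0r//.
have : i.+1%:R <= l%:R :> R by rewrite ler_nat.
lra.
Qed.

Lemma clamp_sum0 {R : realType} {V : lmodType R} (F : nat -> V) (N : nat) :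
  clamp_sum F N (0 : R) = 0.
Proof.
by rewrite /clamp_sum big1// => l _; rewrite clamp_eq0 ?scale0r// sub0r oppr_le0.
Qed.

Lemma clamp_sum_end {R : realType} {V : lmodType R} (F : nat -> V) (N : nat) :
  clamp_sum F N (N%:R : R) = \sum_(0 <= l < N) F l.
Proof.
apply: eq_big_nat => l /andP[_ lN]; rewrite clamp_eq1 ?scale1r//.
by rewrite -natrB ?(ltnW lN)// ler1n subn_gt0.
Qed.

(** The polygonal path that visits the vertex [f l] at time l. *)
Definition polygon {R : realType} {n : nat} (f : nat -> 'rV[R]_n) (N : nat)
    (t : R) : 'rV[R]_n :=
  f 0%N + clamp_sum (fun l => f l.+1 - f l) N t.

(** Length of the edge from [f l] to [f l.+1]. *)
Definition edge_length {R : realType} {n : nat} (f : nat -> 'rV[R]_n)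
    (l : nat) : R := enorm (f l.+1 - f l).

Lemma polygonE {R : realType} {n : nat} (f : nat -> 'rV[R]_n) (N i : nat)
    (t : R) : (i < N)%N -> i%:R <= t <= i.+1%:R ->
  polygon f N t = f i + (t - i%:R) *: (f i.+1 - f i).
Proof.
move=> iN it; rewrite /polygon (clamp_sumE _ _ _ _ iN it) telescope_sumr//.
by rewrite addrA [f 0%N + _]addrC subrK.
Qed.

Lemma polygon0 {R : realType} {n : nat} (f : nat -> 'rV[R]_n) (N : nat) :
  polygon f N 0 = f 0%N.
Proof. by rewrite /polygon clamp_sum0 addr0. Qed.

Lemma polygon_end {R : realType} {n : nat} (f : nat -> 'rV[R]_n) (N : nat) :
  polygon f N N%:R = f N.
Proof. by rewrite /polygon clamp_sum_end telescope_sumr// addrC subrK. Qed.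

Lemma polygon_continuous {R : realType} {n : nat} (f : nat -> 'rV[R]_n)
    (N : nat) : continuous (polygon f N).
Proof.
move=> t; apply: cvgD; first exact: cvg_cst.
apply: cvg_big => [|l _]; first exact: add_continuous.
apply: cvgZr_tmp; apply: (@continuous_comp _ _ _ (fun t : R => t - l%:R) clamp).
  by apply: cvgB; [exact: cvg_id|exact: cvg_cst].
exact: clamp_continuous.
Qed.

(** Length of the edges that are traversed up to the time t, the last one being
    counted in proportion to its part that has been traversed. *)
Definition polygon_length {R : realType} {n : nat} (f : nat -> 'rV[R]_n)
    (N : nat) (t : R) : R := clamp_sum (edge_length f : nat -> R^o) N t.

Lemma polygon_incr {R : realType} {n : nat} (f : nat -> 'rV[R]_n) (N : nat)
    (s t : R) : s <= t ->
  enorm (polygon f N t - polygon f N s) <=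
    polygon_length f N t - polygon_length f N s.
Proof.
move=> st; rewrite /polygon opprD addrACA subrr add0r.
rewrite /polygon_length /clamp_sum -!sumrB.
apply: (le_trans (ler_enorm_sum _ _ _ _)); apply: ler_sum => l _.
rewrite -scalerBl -[X in _ <= X](scalerBl (V := R^o)) enormZ ger0_norm//.
by rewrite subr_ge0 clamp_homo// lerB.
Qed.

Lemma polygon_path_length_le {R : realType} {n : nat} (f : nat -> 'rV[R]_n)
    (N : nat) (s t : R) :
  (path_length (polygon f N) s t <=
     (polygon_length f N t - polygon_length f N s)%:E)%E.
Proof. by apply: path_length_le => s' t'; exact: polygon_incr. Qed.

Lemma edge_length_ge0 {R : realType} {n : nat} (f : nat -> 'rV[R]_n) (l : nat) :
  0 <= edge_length f l.
Proof. exact: enorm_ge0. Qed.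

Lemma unit_interval_l {R : realType} (N : nat) (t : R) : 0 <= t -> t < N%:R ->
  exists2 i, (i < N)%N & i%:R <= t < i.+1%:R.
Proof.
move=> t0 tN; exists (Num.truncn t); last first.
  by rewrite truncnS_gt andbT; have := truncn_le t; rewrite t0.
rewrite -(ltr_nat R); apply: le_lt_trans tN.
by have := truncn_le t; rewrite t0.
Qed.

Lemma unit_interval_r {R : realType} (N : nat) (t : R) : 0 < t -> t <= N%:R ->
  exists2 i, (i < N)%N & i%:R < t <= i.+1%:R.
Proof.
move=> t0 tN; have ex : exists k, t <= k%:R by exists N.
case: (ex_minnP ex) => -[|i] ti imin; first by move: ti; rewrite leNgt t0.
exists i; first exact: imin.
by rewrite ti andbT ltNge; apply/negP => /imin; rewrite ltnn.
Qed.

Lemma unit_interval {R : realType} (N : nat) (t : R) : (0 < N)%N ->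
  0 <= t <= N%:R -> exists2 i, (i < N)%N & i%:R <= t <= i.+1%:R.
Proof.
move=> N0 /andP[]; rewrite le_eqVlt => /predU1P[<- _|t0 tN].
  by exists 0%N => //; rewrite lexx ler01.
have [i iN /andP[it ti]] := unit_interval_r N t t0 tN.
by exists i => //; rewrite ti ltW.
Qed.

(** * Shortest chains are injective *)

Lemma shortest_chain_neq {R : realType} {n : nat} (D : set 'rV[R]_n)
    (N : nat) (f : nat -> 'rV[R]_n) (i : nat) : shortest_chain D N f ->
  (i < N)%N -> f i != f i.+1.
Proof.
move=> hf iN; apply/eqP => fi.
have := shortest_chain_sub D N f i i.+1 0 hf (leqnSn i) iN fi.
by rewrite subSnn.
Qed.

(** Two edges that are not consecutive are disjoint: otherwise the chain could be
    shortened by turning at the common point. *)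
Lemma shortest_chain_disjoint {R : realType} {n : nat} (D : set 'rV[R]_n)
    (N : nat) (f : nat -> 'rV[R]_n) (i k : nat) (s t : R) :
  shortest_chain D N f -> (i.+1 < k)%N -> (k < N)%N ->
  0 <= s <= 1 -> 0 <= t <= 1 ->
  f i + s *: (f i.+1 - f i) <> f k + t *: (f k.+1 - f k).
Proof.
move=> hf ik kN s01 t01 E; have [hadm _] := hf.
have ai := hadm i (ltn_trans (ltnSn i) (ltn_trans ik kN)); have ak := hadm k kN.
have r1 : reach D 1 (f i) (f i + s *: (f i.+1 - f i)).
  apply: reach1; have := admissible_sub D _ _ 0 s ai.
  by rewrite scale0r addr0; apply; rewrite ?lexx ?ler01.
have r2 : reach D 1 (f k + t *: (f k.+1 - f k)) (f k.+1).
  apply: reach1; have := admissible_sub D _ _ t 1 ak t01.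
  by rewrite scale1r [f k + (f k.+1 - f k)]addrC subrK; apply; rewrite ?lexx ?ler01.
rewrite -E in r2.
have ik' : (i <= k.+1)%N by lia.
have := shortest_chain_sub D N f i k.+1 _ hf ik' kN (reach_cat D _ _ _ _ _ r1 r2).
lia.
Qed.

(** Two consecutive edges only share their common vertex: otherwise they overlap
    and the chain could be shortened by omitting this vertex. *)
Lemma shortest_chain_consecutive {R : realType} {n : nat} (D : set 'rV[R]_n)
    (N : nat) (f : nat -> 'rV[R]_n) (i : nat) (s t : R) :
  shortest_chain D N f -> (i.+1 < N)%N -> 0 <= s < 1 -> 0 < t <= 1 ->
  f i + s *: (f i.+1 - f i) <> f i.+1 + t *: (f i.+2 - f i.+1).
Proof.
move=> hf iN s01 t01 E; have [hadm _] := hf.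
have a1 := hadm i (ltnW iN); have a2 := hadm i.+1 iN.
suff a : admissible D (f i) (f i.+2).
  have ii2 : (i <= i.+2)%N by lia.
  have := shortest_chain_sub D N f i i.+2 1 hf ii2 iN (reach1 D _ _ a); lia.
have {}E : t *: (f i.+2 - f i.+1) = (1 - s) *: (f i - f i.+1).
  apply: (@addrI _ (f i.+1)); rewrite -E scalerBl scale1r [RHS]addrA.
  rewrite [f i.+1 + (f i - _)]addrC subrK -[f i - f i.+1]opprB scalerN opprK.
  by [].
have [ts|st] := leP (1 - s) t.
  (* f i.+2 is on the edge from f i to f i.+1 *)
  have -> : f i.+2 = f i.+1 + (t^-1 * (1 - s)) *: (f i - f i.+1).
    rewrite -scalerA -E scalerA mulVf ?scale1r; last by rewrite gt_eqF; lra.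
    by rewrite addrC subrK.
  have := admissible_sub D _ _ 1 (t^-1 * (1 - s)) (admissible_sym D _ _ a1).
  rewrite scale1r [f i.+1 + (f i - _)]addrC subrK; apply; first by rewrite ler01 lexx.
  rewrite mulr_ge0 ?invr_ge0/=; [|lra..].
  by rewrite mulrC ler_pdivrMr; lra.
(* f i is on the edge from f i.+1 to f i.+2 *)
have -> : f i = f i.+1 + ((1 - s)^-1 * t) *: (f i.+2 - f i.+1).
  rewrite -scalerA E scalerA mulVf ?scale1r; last by rewrite gt_eqF; lra.
  by rewrite addrC subrK.
have := admissible_sub D _ _ ((1 - s)^-1 * t) 1 a2.
rewrite scale1r [f i.+1 + (f i.+2 - _)]addrC subrK; apply; last by rewrite ler01 lexx.
rewrite mulr_ge0 ?invr_ge0/=; [|lra..].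
by rewrite mulrC ler_pdivrMr; lra.
Qed.

Lemma shortest_chain_polygon_inj {R : realType} {n : nat} (D : set 'rV[R]_n)
    (N : nat) (f : nat -> 'rV[R]_n) : shortest_chain D N f ->
  set_inj `[0, N%:R] (polygon f N).
Proof.
move=> hf.
suff lt_neq s t : 0 <= s -> s < t -> t <= N%:R -> polygon f N s <> polygon f N t.
  move=> s t; rewrite !inE/= !in_itv/= => /andP[s0 sN] /andP[t0 tN] E.
  by have [st|ts|//] := ltgtP s t; [have := lt_neq s t s0 st tN|
                                    have := lt_neq t s t0 ts sN; rewrite E].
move=> s0 st tN.
have [i iN /andP[is_ si]] := unit_interval_l N s s0 (lt_le_trans st tN).
have [k kN /andP[kt tk]] := unit_interval_r N t (le_lt_trans s0 st) tN.
rewrite (polygonE f N i s) ?is_ ?(ltW si)// (polygonE f N k t) ?tk ?(ltW kt)//.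
have iS : i.+1%:R = i%:R + 1 :> R by rewrite natr1.
have kS : k.+1%:R = k%:R + 1 :> R by rewrite natr1.
have ik : (i <= k)%N.
  by rewrite -ltnS -(ltr_nat R); apply: (le_lt_trans is_); exact: lt_le_trans tk.
move: ik; rewrite leq_eqVlt => /predU1P[ik|].
  rewrite -ik in kt tk *; move/addrI/eqP.
  rewrite -subr_eq0 -scalerBl scaler_eq0 subr_eq0 => /orP[/eqP|].
    by lra.
  by rewrite subr_eq0 eq_sym (negbTE (shortest_chain_neq D N f i hf iN)).
rewrite leq_eqVlt => /predU1P[ik|ik].
  rewrite -ik in kN kS kt tk *.
  by apply: (shortest_chain_consecutive D N) => //; lra.
by apply: (shortest_chain_disjoint D N) => //; lra.
Qed.


(** * Shortest chains when m <= c1 j *)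

Lemma j_metric_ge0 {R : realType} {n : nat} (D : set 'rV[R]_n)
    (x y : 'rV[R]_n) : proper_subdomain D -> D x -> D y -> 0 <= j_metric D x y.
Proof.
move=> hD Dx Dy; rewrite mulr_ge0 ?invr_ge0// ln_ge0//.
have ge1 z : D z -> 1 <= 1 + enorm (x - y) / bdist D z.
  by move=> Dz; rewrite lerDl divr_ge0 ?enorm_ge0// ltW// bdist_gt0.
by have := ge1 x Dx; have := ge1 y Dy; nra.
Qed.

Lemma j_metric_le {R : realType} {n : nat} (D : set 'rV[R]_n)
    (x y : 'rV[R]_n) (rho W : R) : 0 < rho -> rho <= bdist D x ->
  rho <= bdist D y -> enorm (x - y) <= W -> j_metric D x y <= ln (1 + W / rho).
Proof.
move=> rho0 rx ry xyW; have d0 := enorm_ge0 (x - y).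
have le z : rho <= bdist D z ->
    0 <= enorm (x - y) / bdist D z <= W / rho.
  move=> rz; have bz : 0 < bdist D z by exact: lt_le_trans rz.
  rewrite divr_ge0 ?(ltW bz)//= ler_pM ?invr_ge0 ?(ltW bz)//.
  by rewrite lef_pV2 ?posrE.
have /andP[hx hx'] := le x rx; have /andP[hy hy'] := le y ry.
have W0 : 0 < 1 + W / rho by lra.
rewrite /j_metric lnM ?posrE; try lra.
have : ln (1 + enorm (x - y) / bdist D x) <= ln (1 + W / rho).
  by rewrite ler_ln ?posrE; lra.
have : ln (1 + enorm (x - y) / bdist D y) <= ln (1 + W / rho).
  by rewrite ler_ln ?posrE; lra.
lra.
Qed.

(** A natural number that is bounded by its own logarithm is bounded. *)
Lemma log_absorb {R : realType} (A B : R) : 0 < A ->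
  exists C : nat, forall k : nat, k%:R <= A * ln (1 + 4 * k%:R) + B -> (k <= C)%N.
Proof.
move=> A0; exists (Num.truncn (2 * (1 + A * ln (8 * A) + B))).+1 => k hk.
have z0 : 0 < 1 + 4 * k%:R :> R by rewrite ltr_pwDl.
have A8 : 0 < 8 * A by rewrite mulr_gt0.
(* ln z <= z / (8 A) + ln (8 A) for z = 1 + 4 k; the factor 8 A is chosen so
     that the linear term absorbs at most k / 2 *)
have hln : A * ln (1 + 4 * k%:R) <= (1 + 4 * k%:R) / 8 + A * ln (8 * A).
  have q0 : 0 < (1 + 4 * k%:R) / (8 * A) by rewrite divr_gt0.
  have := @le_ln1Dx R ((1 + 4 * k%:R) / (8 * A) - 1).
  rewrite [1 + (_ - 1)]addrC subrK ln_div ?posrE// => h.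
  have {}h : ln (1 + 4 * k%:R) <= (1 + 4 * k%:R) / (8 * A) + ln (8 * A).
    by have := h ltac:(lra); lra.
  apply: (@le_trans _ _ (A * ((1 + 4 * k%:R) / (8 * A) + ln (8 * A)))).
    by rewrite ler_pM2l.
  rewrite mulrDr lerD2r le_eqVlt; apply/orP; left; apply/eqP.
  by field; rewrite gt_eqF.
rewrite -(ler_nat R) ltW// (le_lt_trans _ (truncnS_gt _))//; lra.
Qed.

Lemma chain_dist_le {R : realType} {n : nat} (f : nat -> 'rV[R]_n) (i k : nat) :
  (i <= k)%N -> enorm (f k - f i) <= \sum_(i <= l < k) edge_length f l.
Proof. by move=> ik; rewrite -telescope_sumr//; exact: ler_enorm_sum. Qed.

(** In a chain whose number of steps is controlled by j the distances to the
    boundary and the lengths of the edges form a quasi-chain: if delta is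
    comparable to rho along a subchain of k edges, its ends are at distance at
    most 2 k rho, so that k is bounded by its logarithm. *)
Lemma chain_quasi_chain {R : realType} {n : nat} (A B : R) : 0 < A ->
  exists C : nat, forall (D : set 'rV[R]_n) (N : nat) (f : nat -> 'rV[R]_n),
    proper_subdomain D -> D (f 0%N) ->
    (forall l, (l < N)%N -> admissible D (f l) (f l.+1)) ->
    (forall i k, (i <= k)%N -> (k <= N)%N ->
       (k - i)%:R <= A * j_metric D (f i) (f k) + B) ->
    quasi_chain (fun l => bdist D (f l)) (edge_length f) N C.
Proof.
move=> A0; have [C hC] := log_absorb A B A0; exists C => D N f hD D0 hadm hj.
have Df l : (l <= N)%N -> D (f l).
  case: l => [//|l] lN; have [_ Dl _ _] := admissible_bounds D _ _ (hadm l lN).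
  exact: Dl.
split.
- by move=> l lN; exact/bdist_gt0/Df.
- move=> l lN; have [_ _ h1 h2] := admissible_bounds D _ _ (hadm l lN).
  by split => //; exact: edge_length_ge0.
- move=> l lN; have [_ _ h1 h2] := admissible_bounds D _ _ (hadm l lN).
  have := bdist_lipschitz D (f l) (f l.+1) hD.
  have := bdist_lipschitz D (f l.+1) (f l) hD.
  rewrite (enorm_distC (f l)); lra.
move=> i k rho ik kN rho0 hrho hi hk; apply: hC.
apply: (le_trans (hj i k ik kN)); rewrite lerD2r ler_pM2l//.
have -> : 4 * (k - i)%:R = (k - i)%:R * (2 * rho) / (rho / 2) :> R.
  by field; rewrite gt_eqF.
apply: j_metric_le => //; first by rewrite divr_gt0.
rewrite enorm_distC (le_trans (chain_dist_le f i k ik))//.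
apply: sum_nat_le => // l il lk.
have lN : (l < N)%N := leq_trans lk kN.
have [_ _ h1 h2] := admissible_bounds D _ _ (hadm l lN).
by apply: (le_trans h1); apply: hrho => //; exact: ltnW.
Qed.

Lemma polygon_rectifiable_arc {R : realType} {n : nat} (D : set 'rV[R]_n)
    (N : nat) (f : nat -> 'rV[R]_n) : D (f 0%N) -> shortest_chain D N f ->
  rectifiable_arc D (f 0%N) (f N) (polygon f N) 0 N%:R.
Proof.
move=> D0 hf; split; last exact: (shortest_chain_polygon_inj D).
split => //.
- exact: continuous_subspaceT (polygon_continuous f N).
- move=> _ [t + <-]; rewrite /= in_itv/= => tN.
  case: N => [|N] in hf tN *.
    have -> : t = 0 by lra.
    by rewrite polygon0.
  have [i iN it] := unit_interval N.+1 t (ltn0Sn N) tN.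
  rewrite (polygonE f N.+1 i t iN it).
  have [] // := hf.1 i iN (t - i%:R).
  by move: it; rewrite -natr1; lra.
- by rewrite polygon0 polygon_end.
- by apply: le_lt_trans (polygon_path_length_le f N 0 N%:R) _; exact: ltry.
Qed.

Lemma polygon_lengthE {R : realType} {n : nat} (f : nat -> 'rV[R]_n)
    (N i : nat) (t : R) : (i < N)%N -> i%:R <= t <= i.+1%:R ->
  polygon_length f N t =
    \sum_(0 <= l < i) edge_length f l + (t - i%:R) * edge_length f i.
Proof. exact: clamp_sumE. Qed.

Lemma polygon_length0 {R : realType} {n : nat} (f : nat -> 'rV[R]_n) (N : nat) :
  polygon_length f N 0 = 0.
Proof. exact: clamp_sum0. Qed.

Lemma polygon_length_end {R : realType} {n : nat} (f : nat -> 'rV[R]_n)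
    (N : nat) : polygon_length f N N%:R = \sum_(0 <= l < N) edge_length f l.
Proof. exact: clamp_sum_end. Qed.

Lemma polygon_length_bounds {R : realType} {n : nat} (f : nat -> 'rV[R]_n)
    (N i : nat) (t : R) : (i < N)%N -> i%:R <= t <= i.+1%:R ->
  polygon_length f N t - polygon_length f N 0 <=
    \sum_(0 <= l < i.+1) edge_length f l /\
  polygon_length f N N%:R - polygon_length f N t <=
    \sum_(i <= l < N) edge_length f l.
Proof.
move=> iN it; have e0 := edge_length_ge0 f i.
rewrite polygon_length0 polygon_length_end (polygon_lengthE _ _ _ _ iN it).
rewrite big_nat_recr//=.
have h0 : 0 <= t - i%:R <= 1 by move: it; rewrite -natr1; lra.
rewrite (sum_nat_split _ 0 i N) ?(ltnW iN)//.
have h1 : 0 <= (t - i%:R) * edge_length f i by rewrite mulr_ge0//; lra.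
have h2 : (t - i%:R) * edge_length f i <= edge_length f i by rewrite ler_piMl//; lra.
by split; lra.
Qed.

Lemma m_le_j_uniform {R : realType} {n : nat} (D : set 'rV[R]_n) (c1 : R) :
  (0 < n)%N -> proper_subdomain D -> 1 <= c1 ->
  (forall x y : 'rV[R]_n, D x -> D y ->
     (m_metric D x y <= (c1 * j_metric D x y)%:E)%E) ->
  uniform_domain D.
Proof.
move=> n0 hD c1_ge1 hmj.
pose A := 3 * c1; have A0 : 0 < A by rewrite /A; lra.
have few_steps u v : D u -> D v ->
    exists2 M, M%:R <= A * j_metric D u v + 5 & reach D M u v.
  move=> Du Dv; have j0 := j_metric_ge0 D u v hD Du Dv.
  have cj0 : 0 <= c1 * j_metric D u v by rewrite mulr_ge0//; lra.
  have [||M hM uv] := reach_of_m_metric D u v (c1 * j_metric D u v + 1) n0 hD.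
  - by lra.
  - by apply: (le_lt_trans (hmj u v Du Dv)); rewrite lte_fin ltrDl.
  - by exists M => //; rewrite /A; lra.
have [C hC] := @chain_quasi_chain R n A 5 A0.
pose L : R := 2 * (1 + 2 * C%:R).
pose C2 := (Num.truncn (A * ln (1 + (1 + 2 * L)) + 5)).+1.
pose K : R := (1 + 2 * C%:R) * 2 ^+ C.
pose C3 : R := 4 * (1 + 2 * C%:R) + C2%:R * (2 * 2 ^+ C2).
have K0 : 0 <= K by rewrite !mulr_ge0// addr_ge0// mulr_ge0.
have C30 : 0 <= C3 by rewrite /C3 addr_ge0// mulr_ge0// ?addr_ge0 ?mulr_ge0.
exists (1 + 2 * K + C3); first by lra.
move=> x y Dx Dy.
have [M0 _ xy] := few_steps x y Dx Dy.
have [N [f [hf f0 fN]]] := shortest_chain_exists D x y M0 xy.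
have hadm := hf.1.
have Df l : (l <= N)%N -> D (f l).
  case: l => [|l] lN; first by rewrite f0.
  by have [] := admissible_bounds D _ _ (hadm l lN).
have hj i k : (i <= k)%N -> (k <= N)%N ->
    (k - i)%:R <= A * j_metric D (f i) (f k) + 5.
  move=> ik kN.
  have [M hM ikM] := few_steps _ _ (Df i (leq_trans ik kN)) (Df k kN).
  by apply: le_trans hM; rewrite ler_nat; exact: (shortest_chain_sub D N f).
have D0 : D (f 0%N) by rewrite f0.
have hqc := hC D N f hD D0 hadm hj.
exists (polygon f N), 0, N%:R; split.
- by rewrite -f0 -fN; exact: polygon_rectifiable_arc.
- move=> t; rewrite in_itv/= => tN.
  have [N0|N0] := posnP N.
    have t0 : t = 0 by move: tN; rewrite N0; lra.
    rewrite t0 path_length_xx polygon0 ge_min; apply/orP; left.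
    by rewrite lee_fin mulr_ge0 ?(ltW (bdist_gt0 D _ hD D0))//; lra.
  have [i iN it] := unit_interval N t N0 tN.
  have [M MN [hl hr]] := quasi_chain_peak _ _ _ _ hqc.
  have [S1 S2] := polygon_length_bounds f N i t iN it.
  have [|Dt ht] := hadm i iN (t - i%:R); first by move: it; rewrite -natr1; lra.
  rewrite -(polygonE f N i t iN it) in Dt ht.
  have dt := bdist_gt0 D _ hD Dt.
  have tfi : enorm (polygon f N t - f i) <= enorm (f i.+1 - f i).
    rewrite (polygonE f N i t iN it) addrC addKr enormZ.
    rewrite ler_piMl ?enorm_ge0// ger0_norm; move: it; rewrite -natr1; lra.
  have tfi1 : enorm (f i.+1 - polygon f N t) <= enorm (f i.+1 - f i).
    rewrite (polygonE f N i t iN it) opprD addrA -[X in X - _ *: _]scale1r.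
    rewrite -scalerBl enormZ.
    rewrite ler_piMl ?enorm_ge0// ger0_norm; move: it; rewrite -natr1; lra.
  rewrite ge_min; have [iM|Mi] := ltnP i M.
    apply/orP; left.
    apply: (le_trans (polygon_path_length_le f N 0 t)); rewrite lee_fin.
    apply: (le_trans S1); apply: (le_trans (hl i.+1 iM)); rewrite -/K.
    have := bdist_lipschitz D (f i.+1) (polygon f N t) hD.
    by have := mulr_ge0 C30 (ltW dt); nra.
  apply/orP; right.
  apply: (le_trans (polygon_path_length_le f N t N%:R)); rewrite lee_fin.
  apply: (le_trans S2); apply: (le_trans (hr i Mi (ltnW iN))); rewrite -/K.
  have := bdist_lipschitz D (f i) (polygon f N t) hD.
  rewrite (enorm_distC (f i)).
  by have := mulr_ge0 C30 (ltW dt); nra.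
apply: (le_trans (polygon_path_length_le f N 0 N%:R)); rewrite lee_fin.
rewrite polygon_length0 polygon_length_end subr0.
have d0 := enorm_ge0 (x - y).
have [N2|N2] := leqP N 1.
  (* at most one edge *)
  apply: (@le_trans _ _ (enorm (x - y))); last first.
    by have := mulr_ge0 K0 d0; have := mulr_ge0 C30 d0; lra.
  have [->|Npos] := posnP N; first by rewrite big_nil.
  have N1 : N = 1%N by lia.
  by rewrite N1 in fN *; rewrite big_nat1 /edge_length fN f0 enorm_distC.
have far : ~ admissible D x y.
  move=> /reach1; rewrite -f0 -fN => /(hf.2 1%N).
  by rewrite leqNgt N2.
have rx : bdist D x <= 2 * enorm (x - y).
  rewrite leNgt; apply/negP => h; apply: far.
  by apply: admissible_near => //; rewrite enorm_distC; lra.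
have ry : bdist D y <= 2 * enorm (x - y).
  rewrite leNgt; apply/negP => h; apply/far/admissible_sym.
  by apply: admissible_near => //; lra.
have dgt0 : 0 < enorm (x - y) by have := bdist_gt0 D x hD Dx; lra.
apply: (@le_trans _ _ (C3 * enorm (x - y))); last first.
  by have := mulr_ge0 K0 d0; lra.
apply: (quasi_chain_length _ _ _ _ _ _ hqc dgt0); rewrite ?f0 ?fN//.
move=> u v uv vN du dv Su Sv.
rewrite -(ler_nat R); apply: (le_trans (hj u v uv vN)).
apply: ltW; apply: le_lt_trans (truncnS_gt _).
rewrite lerD2r ler_pM2l//.
have -> : 1 + 2 * L = (1 + 2 * L) * enorm (x - y) / enorm (x - y).
  by field; rewrite gt_eqF.
apply: j_metric_le => //.
have h1 := chain_dist_le f 0 u (leq0n u).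
have h2 := chain_dist_le f v N vN.
have h3 := enorm_triangle x (f u) (f v).
have h4 := enorm_triangle y x (f v).
rewrite f0 in h1; rewrite fN in h2; rewrite -/L in Su Sv; lra.
Qed.

Theorem proposition3p6 (R : realType) (n : nat) (hn : (2 <= n)%N)
    (D : set 'rV[R]_n) (hD : proper_subdomain D) :
  uniform_domain D <->
  exists2 c1 : R, 1 <= c1 &
    forall x y : 'rV[R]_n, D x -> D y ->
      (m_metric D x y <= (c1 * j_metric D x y)%:E)%E.
Proof.
have n0 : (0 < n)%N by exact: ltnW.
split; first exact: uniform_m_le_j.
by move=> [c1 c1_ge1 hmj]; exact: (m_le_j_uniform D c1).
Qed.
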